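(* The following are equivalent: (1) The Finitistic Dimension Conjecture holds for Artin algebras, i.e. $\mathsf{fin.dim}\,A<\infty$ for every Artin algebra $A$. (2) For every basic Artin algebra $A$ there exist (i) a basic Artin algebra $B$ with $\mathsf{fin.dim}\,B<\infty$, and (ii) a homomorphism $\phi\colon A\to B$ with superfluous kernel and of finite projective dimension.
   Context: $\mathsf{fin.dim}\,R$ is the supremum of the projective dimensions of finitely generated left $R$-modules of finite projective dimension. The kernel of a ring homomorphism $\phi\colon A\to B$ is called superfluous if $\mathrm{Ker}\,\phi\subseteq J(A)$, where $J(A)$ is the Jacobson radical. $\phi$ is of finite projective dimension if $B$, viewed as a right $A$-module via restriction of scalars along $\phi$, has finite projective dimension. An Artin algebra $A$ is basic if, for a complete set $\{e_i\}_i$ of primitive orthogonal idempotents, the modules $Ae_i$ are pairwise non-isomorphic. *)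

(* Defs.v *)
From HB Require Import structures.
From mathcomp Require Import all_boot all_order all_algebra.
From mathcomp Require Import boolp.

Set Implicit Arguments.
Unset Strict Implicit.
Unset Printing Implicit Defensive.

Import GRing.Theory.
Local Open Scope ring_scope.

(* Rings are unital, not necessarily commutative, and may be zero
   (pzRingType).  Left R-modules are lmodType R, right R-modules are
   lmodType R^c, and R^o is R as a left module over itself. *)

Definition finitely_generated (R : pzRingType) (M : lmodType R) : Prop :=
  exists (n : nat) (g : 'I_n -> M),
    forall x : M, exists c : 'I_n -> R, x = \sum_i c i *: g i.

Definition isomorphic (R : pzRingType) (M N : lmodType R) : Prop :=
  exists f : {linear M -> N}, bijective f.

Definition surjective_map (S T : Type) (f : S -> T) : Prop :=
  forall y, exists x, f x = y.

Definition projective (R : pzRingType) (P : lmodType R) : Prop :=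
  forall (U V : lmodType R) (p : {linear U -> V}) (f : {linear P -> V}),
    surjective_map p -> exists h : {linear P -> U}, forall x, p (h x) = f x.

(* ... -> P_2 -> P_1 -> P_0 -> M -> 0 exact, with every P_i projective. *)
Record proj_resolution (R : pzRingType) (M : lmodType R) := ProjResolution {
  res_term : nat -> lmodType R;
  res_diff : forall i, {linear res_term i.+1 -> res_term i};
  res_aug : {linear res_term 0%N -> M};
  res_projective : forall i, projective (res_term i);
  res_aug_surj : surjective_map res_aug;
  res_exact0 : forall x, res_aug x = 0 <-> exists y, res_diff 0%N y = x;
  res_exact : forall i x,
    res_diff i x = 0 <-> exists y, res_diff i.+1 y = x
}.

(* pd M <= n; in particular this holds of the zero module for every n. *)
Definition pd_le (R : pzRingType) (M : lmodType R) (n : nat) : Prop :=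
  exists res : proj_resolution M,
    forall i, (n < i)%N -> forall x : res_term res i, x = 0.

Definition finite_pd (R : pzRingType) (M : lmodType R) : Prop :=
  exists n, pd_le M n.

(* fin.dim R <= n: n is an upper bound of the projective dimensions whose
   supremum is fin.dim R. *)
Definition findim_le (R : pzRingType) (n : nat) : Prop :=
  forall M : lmodType R, finitely_generated M -> finite_pd M -> pd_le M n.

Definition finite_findim (R : pzRingType) : Prop := exists n, findim_le R n.

Definition left_ideal (R : pzRingType) (I : {pred R^o}) : Prop :=
  submod_closed I.

Definition maximal_left_ideal (R : pzRingType) (I : {pred R^o}) : Prop :=
  [/\ left_ideal I, (1 : R) \notin I
    & forall J : {pred R^o}, left_ideal J -> (1 : R) \notin J ->
        {subset I <= J} -> J =i I].

Definition jacobson (R : pzRingType) (x : R) : Prop :=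
  forall I : {pred R^o}, maximal_left_ideal I -> x \in I.

Definition left_artinian (R : pzRingType) : Prop :=
  forall I : nat -> {pred R^o},
    (forall n, left_ideal (I n)) -> (forall n, {subset I n.+1 <= I n}) ->
    exists N, forall n, (N <= n)%N -> I n =i I N.

(* The carrier of S as a right R-module along phi : R -> S, i.e.
   x . a = x * phi a. *)
Definition restr (R S : pzRingType) (phi : {rmorphism R -> S}) : Type := S.

Section Restr.
Variables (R S : pzRingType) (phi : {rmorphism R -> S}).

HB.instance Definition _ := GRing.Zmodule.on (restr phi).

Definition restr_scale (a : R^c) (x : restr phi) : restr phi :=
  (x : S) * phi a.

Fact restr_scalerA a b x :
  restr_scale a (restr_scale b x) = restr_scale (a * b) x.
Proof. by rewrite /restr_scale -mulrA -rmorphM. Qed.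

Fact restr_scale1r : left_id 1 restr_scale.
Proof. by move=> x; rewrite /restr_scale rmorph1 mulr1. Qed.

Fact restr_scalerDr : right_distributive restr_scale +%R.
Proof. by move=> a x y; rewrite /restr_scale mulrDl. Qed.

Fact restr_scalerDl x : {morph restr_scale^~ x : a b / a + b}.
Proof. by move=> a b; rewrite /restr_scale rmorphD mulrDr. Qed.

HB.instance Definition _ := GRing.Zmodule_isLmodule.Build R^c (restr phi)
  restr_scalerA restr_scale1r restr_scalerDr restr_scalerDl.

End Restr.

Definition right_restriction (R S : pzRingType) (phi : {rmorphism R -> S}) :
  lmodType R^c := restr phi.

Definition superfluous_kernel (R S : pzRingType) (phi : {rmorphism R -> S}) :
  Prop := forall a, phi a = 0 -> jacobson a.

Definition finite_pd_morphism (R S : pzRingType) (phi : {rmorphism R -> S}) :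
  Prop := finite_pd (right_restriction phi).

(* A is an algebra over some commutative artinian ring k, by a structure
   morphism s into the centre of A, and is finitely generated over k.
   (MathComp's algType is not used, as it excludes the zero ring.) *)
Definition artin_algebra (A : pzRingType) : Prop :=
  exists (k : comPzRingType) (s : {rmorphism k -> A}),
    [/\ left_artinian k, forall c x, s c * x = x * s c
      & finitely_generated (right_restriction s)].

Definition left_multiples (R : pzRingType) (e : R) : {pred R^o} :=
  fun x => `[< exists a : R, x = a * e >].

(* The left R-module R e. *)
Record principal (R : pzRingType) (e : R) := Principal {
  principal_val : R^o;
  _ : principal_val \in left_multiples e
}.

Section Principal.
Variables (R : pzRingType) (e : R).

Fact left_multiples_submod : submod_closed (left_multiples e).
Proof.
split=> [|a _ _ /asboolP[x ->] /asboolP[y ->]]; apply/asboolP.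
  by exists 0; rewrite mul0r.
by exists (a * x + y); rewrite mulrDl -mulrA.
Qed.

HB.instance Definition _ :=
  GRing.isSubmodClosed.Build R R^o (left_multiples e) left_multiples_submod.

HB.instance Definition _ := [isSub for @principal_val R e].
HB.instance Definition _ := [Choice of principal e by <:].
HB.instance Definition _ :=
  [SubChoice_isSubLmodule of principal e by <:].

End Principal.

Definition idempotent_elt (R : pzRingType) (e : R) : Prop := e * e = e.

Definition primitive_idempotent (R : pzRingType) (e : R) : Prop :=
  [/\ idempotent_elt e, e <> 0
    & forall f g : R, idempotent_elt f -> idempotent_elt g ->
        f * g = 0 -> g * f = 0 -> e = f + g -> f = 0 \/ g = 0].

Definition complete_primitive_orthogonal (R : pzRingType) (n : nat)
    (e : 'I_n -> R) : Prop :=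
  [/\ forall i, primitive_idempotent (e i),
      forall i j, i != j -> e i * e j = 0
    & \sum_i e i = 1].

Definition basic (R : pzRingType) : Prop :=
  exists (n : nat) (e : 'I_n -> R),
    complete_primitive_orthogonal e /\
    forall i j, i != j -> ~ isomorphic (principal (e i)) (principal (e j)).

(* Main.v *)
Require Import Defs.
From HB Require Import structures.
From mathcomp Require Import all_boot all_order all_algebra.
From mathcomp Require Import boolp.
From mathcomp Require classical_sets.
From mathcomp Require Import functions.

(** If the conjecture holds, then [B := A] with the identity map satisfies the
    condition, since [A] is free as a right module over itself.

    For the converse, an Artin algebra [A] is first replaced by a basic one.
    The identity of [A] is a sum of primitive orthogonal idempotents
    ([primitive_decomposition]); let [e] be the sum of one of them from each
    isomorphism class.  Then [e] is full, [e A e] is a basic Artin algebra, and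
    [M |-> e M] is exact and preserves and reflects projectivity, so finiteness
    of the finitistic dimension passes from [e A e] to [A]
    ([basic_reduction]).

    Now let [phi : A -> B] be as in the condition, [d] the projective dimension
    of [B] as a right [A]-module, and [M] a finitely generated [A]-module of
    finite projective dimension.  As Tor against [B] vanishes above degree [d],
    tensoring with [B] keeps the free resolution of a [d]-th syzygy of [M]
    exact.  Hence the base change of a further syzygy [N] has finite
    projective dimension over [B], so its projective dimension is at most the
    bound [n] for [B], and it remains to see that [N] itself has projective
    dimension at most [n].  By descending along the resolution this reduces to
    a statement about a single map between finitely generated projectives
    ([change_rings_regular]): if it splits over [B], it splits over [A].  For a
    split injection over [B], an element of the source mapped into the radical
    lies in the radical.  This transfers to [A] because [phi] preserves and
    reflects the radical, so the map is injective modulo the radical; since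
    free modules are semisimple modulo the radical ([complement_mod_rad]), it
    has a left inverse modulo the radical, which Nakayama's lemma corrects to
    an actual one.

    The two hypotheses on [phi] enter through the radical.  Elements of the
    radical of [A] are nilpotent, and a nilpotent element of a basic ring [B]
    lies in its radical, because [B] modulo the radical is a product of
    division rings ([basic_nilpotent_jacobson]).  Conversely, the preimage of
    the radical of [B] contains no nonzero idempotent: such an idempotent is
    mapped to an idempotent in the radical, which is zero, so it lies in the
    superfluous kernel.  As a left ideal with non-nilpotent elements contains a
    nonzero idempotent ([nonnil_idempotent]), the preimage lies in the radical
    of [A] ([superfluous_basic_findim]).

    Modules obtained from free ones are represented by matrices acting on row
    vectors: tensoring with [B] is then the application of [phi] to the entries
    of a matrix, and a base-changed syzygy is the image of such a matrix. *)

Set Implicit Arguments.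
Unset Strict Implicit.
Unset Printing Implicit Defensive.

Import GRing.Theory.
Local Open Scope ring_scope.

(** * Linear maps, submodules and short exact sequences *)

Section MkLinear.
Variables (R : pzRingType) (U V : lmodType R) (f : U -> V).
Hypothesis f_linear : linear f.

Definition linear_fun (_ : linear f) : U -> V := f.

HB.instance Definition _ :=
  GRing.isLinear.Build R U V *:%R (linear_fun f_linear) f_linear.

Definition mkLinear : {linear U -> V} := linear_fun f_linear.

Lemma mkLinearE x : mkLinear x = f x.
Proof. by []. Qed.

End MkLinear.

(** Membership is a proposition because the submodules below arise from
    quantifiers and from choice; [sub_pred] turns it into a boolean
    predicate where a subtype is formed. *)
Record submodule (R : pzRingType) (V : lmodType R) := Submodule {
  sub_mem :> V -> Prop;
  sub_mem0 : sub_mem 0;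
  sub_memZD : forall a x y, sub_mem x -> sub_mem y -> sub_mem (a *: x + y)
}.

Section SubmoduleTheory.
Variables (R : pzRingType) (V : lmodType R) (S : submodule V).

Lemma sub_memD x y : S x -> S y -> S (x + y).
Proof. by move=> Sx Sy; rewrite -[x]scale1r; apply: sub_memZD. Qed.

Lemma sub_memZ a x : S x -> S (a *: x).
Proof. by move=> Sx; rewrite -[_ *: _]addr0; apply/sub_memZD/sub_mem0. Qed.

Lemma sub_memN x : S x -> S (- x).
Proof. by rewrite -scaleN1r; apply: sub_memZ. Qed.

Lemma sub_memB x y : S x -> S y -> S (x - y).
Proof. by move=> Sx Sy; apply/sub_memD/sub_memN. Qed.

Lemma sub_mem_sum (I : Type) (r : seq I) (P : pred I) (F : I -> V) :
  (forall i, P i -> S (F i)) -> S (\sum_(i <- r | P i) F i).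
Proof.
by move=> SF; apply: big_ind => //; [exact: sub_mem0|exact: sub_memD].
Qed.

Definition sub_pred : {pred V} := fun x => `[< S x >].

Fact sub_pred_submod : submod_closed sub_pred.
Proof.
split=> [|a x y /asboolP Sx /asboolP Sy]; apply/asboolP; first exact: sub_mem0.
exact: sub_memZD.
Qed.

HB.instance Definition _ :=
  GRing.isSubmodClosed.Build R V sub_pred sub_pred_submod.

Record carrier := Carrier { carrier_val : V; _ : carrier_val \in sub_pred }.

HB.instance Definition _ := [isSub for carrier_val].
HB.instance Definition _ := [Choice of carrier by <:].
HB.instance Definition _ := [SubChoice_isSubLmodule of carrier by <:].

Fact carrier_val_linear : linear (val : carrier -> V).
Proof. by []. Qed.

Definition incl : {linear carrier -> V} := mkLinear carrier_val_linear.

Lemma inclP (x : carrier) : S (incl x).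
Proof. by apply/asboolP; exact: (valP x). Qed.

Lemma incl_inj : injective incl.
Proof. exact: val_inj. Qed.

Definition to_carrier x (Sx : S x) : carrier := Sub x (asboolT Sx).

Lemma incl_to x (Sx : S x) : incl (to_carrier Sx) = x.
Proof. by rewrite mkLinearE SubK. Qed.

Lemma inclE x : S x -> exists y, incl y = x.
Proof. by move=> Sx; exists (to_carrier Sx); rewrite incl_to. Qed.

Section Corestriction.
Variables (U : lmodType R) (f : {linear U -> V}) (fS : forall x, S (f x)).

Fact cores_linear : linear (fun x => to_carrier (fS x)).
Proof.
by move=> a x y; apply: incl_inj; rewrite [RHS]linearP !incl_to linearP.
Qed.

Definition cores : {linear U -> carrier} := mkLinear cores_linear.

Lemma incl_cores x : incl (cores x) = f x.
Proof. exact: incl_to. Qed.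

End Corestriction.
End SubmoduleTheory.

Section KerIm.
Variables (R : pzRingType) (U V : lmodType R) (f : {linear U -> V}).

Fact ker_memZD a x y : f x = 0 -> f y = 0 -> f (a *: x + y) = 0.
Proof. by move=> fx fy; rewrite linearP fx fy scaler0 addr0. Qed.

Definition sub_ker : submodule U :=
  @Submodule _ _ (fun x => f x = 0) (linear0 f) ker_memZD.

Fact image_mem0 (S : submodule U) : exists2 y, S y & f y = 0.
Proof. by exists 0; [exact: sub_mem0|rewrite linear0]. Qed.

Fact image_memZD (S : submodule U) a x y :
  (exists2 z, S z & f z = x) -> (exists2 z, S z & f z = y) ->
  exists2 z, S z & f z = a *: x + y.
Proof.
move=> [u Su <-] [v Sv <-]; exists (a *: u + v); last by rewrite linearP.
exact: sub_memZD.
Qed.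

Definition sub_image (S : submodule U) : submodule V :=
  @Submodule _ _ (fun x => exists2 y, S y & f y = x) (image_mem0 S)
    (@image_memZD S).

Fact preimage_mem0 (S : submodule V) : S (f 0).
Proof. by rewrite linear0; exact: sub_mem0. Qed.

Fact preimage_memZD (S : submodule V) a x y :
  S (f x) -> S (f y) -> S (f (a *: x + y)).
Proof. by move=> Sx Sy; rewrite linearP; exact: sub_memZD. Qed.

Definition sub_preimage (S : submodule V) : submodule U :=
  @Submodule _ _ (fun x => S (f x)) (preimage_mem0 S) (@preimage_memZD S).

End KerIm.

Section Lattice.
Variables (R : pzRingType) (V : lmodType R).

Definition full_sub : submodule V :=
  @Submodule R V (fun=> True) I (fun _ _ _ _ _ => I).

Fact zero_sub_memZD (a : R) (x y : V) : x = 0 -> y = 0 -> a *: x + y = 0.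
Proof. by move=> -> ->; rewrite scaler0 addr0. Qed.

Definition zero_sub : submodule V :=
  @Submodule R V (fun x => x = 0) erefl zero_sub_memZD.

Variables S T : submodule V.

Fact cap_memZD (a : R) (x y : V) :
  S x /\ T x -> S y /\ T y -> S (a *: x + y) /\ T (a *: x + y).
Proof. by move=> [? ?] [? ?]; split; exact: sub_memZD. Qed.

Definition sub_cap : submodule V :=
  Submodule (conj (sub_mem0 S) (sub_mem0 T)) cap_memZD.

Fact sum_mem0 : exists2 y, S y & T (0 - y).
Proof. by exists 0; rewrite ?subr0; exact: sub_mem0. Qed.

Fact sum_memZD (a : R) (x y : V) :
  (exists2 z, S z & T (x - z)) -> (exists2 z, S z & T (y - z)) ->
  exists2 z, S z & T (a *: x + y - z).
Proof.
move=> [u Su Tu] [v Sv Tv]; exists (a *: u + v); first exact: sub_memZD.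
by rewrite opprD addrACA -scalerBr; exact: sub_memZD.
Qed.

Definition sub_sum : submodule V := Submodule sum_mem0 sum_memZD.

End Lattice.

Definition ses (R : pzRingType) (K P M : lmodType R)
    (i : {linear K -> P}) (p : {linear P -> M}) : Prop :=
  [/\ injective i, surjective_map p & forall x, p x = 0 <-> exists y, i y = x].

Lemma ses_ker (R : pzRingType) (P M : lmodType R) (p : {linear P -> M}) :
  surjective_map p -> ses (incl (sub_ker p)) p.
Proof.
move=> ps; split=> [||x]; [exact: incl_inj|exact: ps|].
by split=> [px|[y <-]]; [exact: (@inclE _ _ (sub_ker p))|exact: (inclP y)].
Qed.

Lemma ses_lift (R : pzRingType) (K P M W : lmodType R)
    (i : {linear K -> P}) (p : {linear P -> M}) (f : {linear W -> P}) :
  ses i p -> (forall x, p (f x) = 0) ->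
  exists g : {linear W -> K}, forall x, i (g x) = f x.
Proof.
move=> [iI _ ex] pf.
have /choice[g gP] : forall x, exists y, i y = f x by move=> x; apply/ex.
have gL : linear g by move=> a x y; apply: iI; rewrite linearP !gP linearP.
by exists (mkLinear gL) => x; rewrite mkLinearE.
Qed.

(** * Projective modules and projective dimension *)

Lemma retract_projective (R : pzRingType) (P Q : lmodType R)
    (i : {linear Q -> P}) (p : {linear P -> Q}) :
  cancel i p -> projective P -> projective Q.
Proof.
move=> ip projP U V u f us; have [h hP] := projP U V u (f \o p) us.
by exists (h \o i) => x /=; rewrite hP /= ip.
Qed.

Lemma projective_split (R : pzRingType) (W P : lmodType R)
    (w : {linear W -> P}) : projective P -> surjective_map w ->
  exists s : {linear P -> W}, cancel s w.
Proof. by move=> projP ws; have [s sP] := projP _ _ w idfun ws; exists s. Qed.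

(** A lift is determined by lifting the finitely many images of the [y t], the
    functionals [phi t] providing the coefficients. *)
Lemma dual_basis_projective (R : pzRingType) (P : lmodType R) (T : finType)
    (phi : T -> {linear P -> R^o}) (y : T -> P) :
  (forall x, x = \sum_t (phi t x : R) *: y t) -> projective P.
Proof.
move=> db U V u f us.
have /choice[z zP] : forall t, exists x, u x = f (y t) by move=> t; apply: us.
have hL : linear (fun x => \sum_t (phi t x : R) *: z t).
  move=> a x x'; rewrite scaler_sumr -big_split; apply: eq_bigr => t _ /=.
  by rewrite linearP scalerDl scalerA.
exists (mkLinear hL) => x; rewrite mkLinearE linear_sum {2}(db x) linear_sum.
by apply: eq_bigr => t _; rewrite !linearZ zP.
Qed.

Section Coordinates.
Variables (R : pzRingType) (n : nat).

Fact coord_linear j : linear (fun x : 'rV[R]_n => x 0 j : R^o).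
Proof. by move=> a x y; rewrite !mxE. Qed.

Definition coord j : {linear 'rV[R]_n -> R^o} := mkLinear (coord_linear j).

Lemma row_projective : projective 'rV[R]_n.
Proof.
by apply: (@dual_basis_projective _ _ _ coord (fun j => 'e_j)) => x;
  exact: row_sum_delta.
Qed.

Variables (V : lmodType R) (v : 'I_n -> V).

Fact comb_linear : linear (fun x : 'rV[R]_n => \sum_j x 0 j *: v j).
Proof.
move=> a x y; rewrite scaler_sumr -big_split; apply: eq_bigr => j _ /=.
by rewrite !mxE scalerDl scalerA.
Qed.

Definition comb : {linear 'rV[R]_n -> V} := mkLinear comb_linear.

Lemma combE x : comb x = \sum_j x 0 j *: v j.
Proof. by []. Qed.

Lemma comb_delta j : comb 'e_j = v j.
Proof.
rewrite combE (bigD1 j) //= mxE !eqxx scale1r big1 ?addr0 // => i /negPf ij.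
by rewrite mxE ij andbF scale0r.
Qed.

End Coordinates.

Lemma eq_on_delta (R : pzRingType) n (V : lmodType R)
    (f g : {linear 'rV[R]_n -> V}) :
  (forall j, f 'e_j = g 'e_j) -> forall x, f x = g x.
Proof.
move=> fg x; rewrite [x]row_sum_delta !linear_sum.
by apply: eq_bigr => j _; rewrite !linearZ fg.
Qed.

Lemma fg_cover (R : pzRingType) (M : lmodType R) : finitely_generated M ->
  exists n (p : {linear 'rV[R]_n -> M}), surjective_map p.
Proof.
move=> [n [g gP]]; exists n, (comb g) => x; have [c ->] := gP x.
by exists (\row_j c j); rewrite combE; apply: eq_bigr => j _; rewrite mxE.
Qed.

Lemma cover_fg (R : pzRingType) (M : lmodType R) n
    (p : {linear 'rV[R]_n -> M}) : surjective_map p -> finitely_generated M.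
Proof.
move=> ps; exists n, (fun j => p 'e_j) => x; have [y <-] := ps x.
exists (fun j => y 0 j); rewrite {1}[y]row_sum_delta linear_sum.
by apply: eq_bigr => j _; rewrite linearZ.
Qed.

(** Projective dimension at most [n], peeling off one syzygy at a time: this
    form supports induction on [n] without reindexing resolutions. *)
Fixpoint pdim_le (R : pzRingType) (n : nat) (M : lmodType R) : Prop :=
  if n is n'.+1 then
    exists (P K : lmodType R) (i : {linear K -> P}) (p : {linear P -> M}),
      [/\ projective P, ses i p & pdim_le n' K]
  else projective M.

Lemma iso_projective (R : pzRingType) (M N : lmodType R)
    (f : {linear M -> N}) : bijective f -> projective M -> projective N.
Proof.
move=> [g fg gf] projM.
have gL : linear g.
  by move=> a x y; apply: (can_inj fg); rewrite gf linearP !gf.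
exact: (@retract_projective _ _ _ (mkLinear gL) f).
Qed.

Section PairInjections.
Variables (R : pzRingType) (P Q : lmodType R).

Fact inj1_linear : linear (fun x : P => (x, 0 : Q)).
Proof. by move=> a x y; congr (_, _); rewrite /= scaler0 addr0. Qed.

Fact inj2_linear : linear (fun y : Q => (0 : P, y)).
Proof. by move=> a x y; congr (_, _); rewrite /= scaler0 addr0. Qed.

Definition inj1 : {linear P -> (P * Q)%type} := mkLinear inj1_linear.
Definition inj2 : {linear Q -> (P * Q)%type} := mkLinear inj2_linear.

Lemma inj12E x y : inj1 x + inj2 y = (x, y).
Proof. by congr (_, _); rewrite /= ?addr0 ?add0r. Qed.

End PairInjections.

Lemma pair_projective (R : pzRingType) (P Q : lmodType R) :
  projective P -> projective Q -> projective (P * Q)%type.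
Proof.
move=> projP projQ U V u f us.
have [h hP] := projP _ _ u (f \o inj1 P Q) us.
have [k kP] := projQ _ _ u (f \o inj2 P Q) us.
have hkL : linear (fun x : P * Q => h x.1 + k x.2).
  by move=> a [x x'] [y y'] /=; rewrite !linearP scalerDr addrACA.
exists (mkLinear hkL) => -[x y].
by rewrite mkLinearE linearD hP kP /= -linearD inj12E.
Qed.

Lemma ses_split (R : pzRingType) (K W P : lmodType R)
    (i : {linear K -> W}) (w : {linear W -> P}) :
  ses i w -> projective P ->
  exists (r : {linear W -> K}) (s : {linear P -> W}),
    [/\ cancel i r, cancel s w & forall x, x = i (r x) + s (w x)].
Proof.
move=> ses_iw projP; have [iI ws ex] := ses_iw.
have [s sP] := projective_split projP ws.
have dL : linear (fun x => x - s (w x)).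
  by move=> a x y; rewrite (linearP w) (linearP s) scalerBr opprD addrACA.
have [x|r rP] := ses_lift (f := mkLinear dL) ses_iw.
  by rewrite mkLinearE linearB sP subrr.
exists r, s; split=> // x; last by rewrite rP mkLinearE subrK.
apply: iI; rewrite rP mkLinearE.
by have -> : w (i x) = 0 by [apply/ex; exists x]; rewrite linear0 subr0.
Qed.

(** A map onto a projective module splits, so its kernel and its source have
    projective resolutions of the same lengths. *)
Lemma pdim_le_sub (R : pzRingType) n (K W P : lmodType R)
    (i : {linear K -> W}) (w : {linear W -> P}) :
  ses i w -> projective P -> pdim_le n W -> pdim_le n K.
Proof.
case: n => [|n] iw projP.
  by have [r [s [ri _ _]]] := ses_split iw projP; exact: retract_projective ri.
move=> [Q [L [j [q [projQ jq pdL]]]]].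
have [iI ws ex] := iw; have [jI qs exq] := jq.
have wqs : surjective_map (w \o q).
  by move=> y; have [x <-] := ws y; have [z <-] := qs x; exists z.
have kwq := ses_ker wqs.
have [r [s [rP _ _]]] := ses_split kwq projP.
have projQ' : projective (carrier (sub_ker (w \o q))).
  exact: retract_projective rP projQ.
have [x|g gP] := ses_lift (f := q \o incl (sub_ker (w \o q))) iw.
  exact: (inclP x).
have wqj x : (w \o q) (j x) = 0.
  by have /= -> : q (j x) = 0 by [apply/exq; exists x]; rewrite linear0.
have [j' j'P] := ses_lift kwq wqj.
exists (carrier (sub_ker (w \o q))), L, j', g; split=> //; split.
- by move=> x y /(congr1 (incl _)); rewrite !j'P => /jI.
- move=> x; have [y yE] := qs (i x).
  have [|z zE] := @inclE _ _ (sub_ker (w \o q)) y.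
    by rewrite /= yE; apply/ex; exists x.
  by exists z; apply: iI; rewrite gP /= zE.
- move=> x; split=> [gx|[y <-]].
    have /exq[y yE] : q (incl _ x) = 0 by rewrite -[LHS]gP gx linear0.
    by exists y; apply: incl_inj; rewrite j'P.
  by apply: iI; rewrite gP /= j'P linear0; apply/exq; exists y.
Qed.

Lemma pdim_le_ext (R : pzRingType) n (K W P : lmodType R)
    (i : {linear K -> W}) (w : {linear W -> P}) :
  ses i w -> projective P -> pdim_le n K -> pdim_le n W.
Proof.
move=> iw projP; have [iI ws ex] := iw.
have [r [s [_ sP rsP]]] := ses_split iw projP.
have wi x : w (i x) = 0 by apply/ex; exists x.
have addL (Q : lmodType R) (q : {linear Q -> K}) :
    linear (fun x : Q * P => i (q x.1) + s x.2).
  by move=> a [x x'] [y y'] /=; rewrite !linearP scalerDr addrACA.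
case: n => [projK|n [Q [L [j [q [projQ [jI qs exq] pdL]]]]]] /=.
  have rwL : linear (fun x => (r x, w x)) by move=> a x y; rewrite !linearP.
  apply: (@retract_projective _ _ _ (mkLinear rwL) (mkLinear (addL _ idfun))).
    by move=> x; exact/esym/rsP.
  exact: pair_projective.
exists (Q * P)%type, L, (inj1 Q P \o j), (mkLinear (addL _ q)).
split=> //; first exact: pair_projective.
split=> [x y|x|[x y]].
- by move=> /(congr1 fst)/jI.
- have [y yE] := qs (r x); exists (y, w x).
  by rewrite mkLinearE /= yE; exact/esym/rsP.
- rewrite mkLinearE /=; split=> [qy0|[z]]; last first.
    case=> <- <-; rewrite linear0 addr0.
    have -> : q (j z) = 0 by apply/exq; exists z.
    by rewrite linear0.
  have y0 : y = 0 by have := congr1 w qy0; rewrite linearD wi sP add0r linear0.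
  move: qy0; rewrite y0 linear0 addr0 -(linear0 i) => /iI /exq[z zE].
  by exists z; rewrite mkLinearE zE.
Qed.

(** Schanuel: the first syzygies of two projective covers of the same module
    are both obtained from the pullback by splitting off a projective. *)
Lemma schanuel (R : pzRingType) n (M P K P' K' : lmodType R)
    (i : {linear K -> P}) (p : {linear P -> M})
    (i' : {linear K' -> P'}) (p' : {linear P' -> M}) :
  ses i p -> ses i' p' -> projective P -> projective P' ->
  pdim_le n K -> pdim_le n K'.
Proof.
move=> [iI ps ex] [iI' ps' ex'] projP projP' pdK.
have dL : linear (fun x : P * P' => p x.1 - p' x.2).
  move=> a [x x'] [y y']; rewrite (linearP p) (linearP p') scalerBr opprD.
  exact: addrACA.
pose W := sub_ker (mkLinear dL).
have WP (x : P) (y : P') : p x = p' y ->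
    exists z : carrier W, incl W z = (x, y).
  by move=> xy; apply: inclE; rewrite /= mkLinearE /= xy subrr.
have WE (z : carrier W) : p (incl W z).1 = p' (incl W z).2.
  by apply/eqP; rewrite -subr_eq0; apply/eqP; exact: (inclP z).
have fL : linear (fun z : carrier W => (incl W z).1).
  by move=> a x y; rewrite linearP.
have sL : linear (fun z : carrier W => (incl W z).2).
  by move=> a x y; rewrite linearP.
pose iL := inj1 P P' \o i; pose iL' := inj2 P P' \o i'.
have iW x : W (iL x).
  rewrite /= !mkLinearE /= linear0 subr0; by apply/ex; exists x.
have iW' x : W (iL' x).
  rewrite /= !mkLinearE /= linear0 sub0r.
  suff -> : p' (i' x) = 0 by rewrite oppr0.
  by apply/ex'; exists x.
have ses1 : ses (cores iW) (mkLinear sL).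
  split=> [x y /(congr1 (incl W))|y|z].
  - by rewrite !incl_cores => /(congr1 fst)/iI.
  - have [x xy] := ps (p' y); have [z zE] := WP x y xy.
    by exists z; rewrite mkLinearE zE.
  - rewrite mkLinearE; split=> [z20|[x <-]]; last by rewrite incl_cores.
    have /ex[x xE] : p (incl W z).1 = 0 by rewrite WE z20 linear0.
    exists x; apply: incl_inj; rewrite incl_cores.
    transitivity (i x, 0 : P') => //.
    rewrite xE -z20.
    by case: (incl W z).
have ses2 : ses (cores iW') (mkLinear fL).
  split=> [x y /(congr1 (incl W))|x|z].
  - by rewrite !incl_cores => /(congr1 snd)/iI'.
  - have [y xy] := ps' (p x); have [z zE] := WP x y (esym xy).
    by exists z; rewrite mkLinearE zE.
  - rewrite mkLinearE; split=> [z10|[x <-]]; last by rewrite incl_cores.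
    have /ex'[x xE] : p' (incl W z).2 = 0 by rewrite -WE z10 linear0.
    exists x; apply: incl_inj; rewrite incl_cores.
    transitivity (0 : P, i' x) => //.
    rewrite xE -z10.
    by case: (incl W z).
exact: pdim_le_sub ses2 projP (pdim_le_ext ses1 projP' pdK).
Qed.

Lemma pdim_le_syzygy (R : pzRingType) n (M P K : lmodType R)
    (i : {linear K -> P}) (p : {linear P -> M}) :
  ses i p -> projective P -> pdim_le n.+1 M -> pdim_le n K.
Proof.
move=> ip projP [Q [L [j [q [projQ jq pdL]]]]].
exact: schanuel jq ip projQ projP pdL.
Qed.

Definition zero_module (R : pzRingType) : lmodType R := carrier (zero_sub R^o).

Lemma zero_moduleE (R : pzRingType) (x : zero_module R) : x = 0.
Proof. by apply: incl_inj; rewrite linear0; exact: (inclP x). Qed.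

Lemma zero_module_projective (R : pzRingType) : projective (zero_module R).
Proof.
move=> U V p f ps; exists (GRing.null_fun _) => x.
by rewrite (zero_moduleE x) !linear0.
Qed.

Lemma pd_le_pdim (R : pzRingType) n (M : lmodType R) : pd_le M n -> pdim_le n M.
Proof.
elim: n M => [|n IH] M [[T d a Tproj as_ ex0 ex] /= T0].
  apply: (iso_projective (f := a)) (Tproj 0%N).
  have aI : injective a.
    move=> x y /eqP; rewrite -subr_eq0 -linearB => /eqP /ex0[z zE].
    by apply/eqP; rewrite -subr_eq0 -zE (T0 1%N _ z) ?linear0.
  have [b bP] := choice as_; exists b => // x.
  by apply: aI; rewrite bP.
have da x : a (d 0%N x) = 0 by apply/ex0; exists x.
have [d' d'P] := ses_lift (ses_ker as_) da.
exists (T 0%N), (carrier (sub_ker a)), (incl (sub_ker a)), a; split=> //.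
  exact: ses_ker.
apply: IH.
unshelve eexists (@ProjResolution _ _ (fun i => T i.+1) (fun i => d i.+1) d'
  _ _ _ _).
- by move=> i; exact: Tproj.
- move=> y; have /ex0[x xE] : a (incl _ y) = 0 by exact: (inclP y).
  by exists x; apply: incl_inj; rewrite d'P.
- move=> x; rewrite -ex -d'P; split=> [->|d'x]; first by rewrite linear0.
  by apply: incl_inj; rewrite d'x linear0.
- by move=> i x; exact: ex.
- by move=> i ni x; exact: (T0 i.+1).
Qed.

Section ExtendResolution.
Variables (R : pzRingType) (M P K : lmodType R).
Variables (i : {linear K -> P}) (p : {linear P -> M}) (res : proj_resolution K).
Hypotheses (ip : ses i p) (projP : projective P).

Definition ext_term n : lmodType R := if n is n'.+1 then res_term res n' else P.

Definition ext_diff n : {linear ext_term n.+1 -> ext_term n} :=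
  if n is n'.+1 then res_diff res n' else i \o res_aug res.

Fact ext_projective n : projective (ext_term n).
Proof. by case: n => [|n] //; exact: res_projective. Qed.

Fact ext_exact0 (x : ext_term 0) : p x = 0 <-> exists y, ext_diff 0%N y = x.
Proof.
have [iI _ ex] := ip; rewrite ex; split=> [[y <-]|[y <-]].
  by have [z <-] := res_aug_surj res y; exists z.
by exists (res_aug res y).
Qed.

Fact ext_exact n (x : ext_term n.+1) :
  ext_diff n x = 0 <-> exists y, ext_diff n.+1 y = x.
Proof.
case: n x => [|n] x; last exact: res_exact.
rewrite -res_exact0 /=; have [iI _ _] := ip.
by split=> [|->]; rewrite ?linear0 // -(linear0 i) => /iI.
Qed.

Definition ext_resolution : proj_resolution M :=
  ProjResolution ext_projective (let: And3 _ ps _ := ip in ps)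
    ext_exact0 ext_exact.

End ExtendResolution.

Section TrivialResolution.
Variables (R : pzRingType) (M : lmodType R).
Hypothesis projM : projective M.

Definition triv_term n : lmodType R := if n is 0 then M else zero_module R.

Definition triv_resolution : proj_resolution M.
Proof.
refine (@ProjResolution _ _ triv_term (fun=> GRing.null_fun _) idfun _ _ _ _).
- by case=> [|n] //; exact: zero_module_projective.
- by move=> y; exists y.
- move=> x /=; split=> [->|[_ <-]] //; by exists 0.
- by move=> i x; split=> // _; exists 0; rewrite (zero_moduleE x).
Defined.

End TrivialResolution.

Lemma pdim_le_pd (R : pzRingType) n (M : lmodType R) : pdim_le n M -> pd_le M n.
Proof.
elim: n M => [|n IH] M => [projM|[P [K [i [p [projP ip /IH[res res0]]]]]]].
  by exists (triv_resolution projM) => -[|i] // _ x; exact: zero_moduleE.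
exists (ext_resolution res ip projP) => -[|k] // nk x.
exact: res0.
Qed.

Lemma pdim_leE (R : pzRingType) n (M : lmodType R) : pd_le M n <-> pdim_le n M.
Proof. by split; [exact: pd_le_pdim|exact: pdim_le_pd]. Qed.

Lemma pdim_le_mono (R : pzRingType) m n (M : lmodType R) :
  (m <= n)%N -> pdim_le m M -> pdim_le n M.
Proof.
move=> mn /pdim_leE[res res0]; apply/pdim_leE; exists res => i ni.
exact/res0/(leq_ltn_trans mn).
Qed.

(** * Chain conditions *)

Definition sub_le (R : pzRingType) (V : lmodType R) (S T : submodule V) : Prop :=
  forall x, S x -> T x.

Definition artinian_module (R : pzRingType) (V : lmodType R) : Prop :=
  forall F : submodule V -> Prop, (exists S, F S) ->
    exists2 S, F S & forall T, F T -> sub_le T S -> sub_le S T.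

Definition fg_sub (R : pzRingType) (V : lmodType R) (S : submodule V) : Prop :=
  exists n (p : {linear 'rV[R]_n -> V}), forall x, S x <-> exists y, p y = x.

Definition noetherian_module (R : pzRingType) (V : lmodType R) : Prop :=
  forall S : submodule V, fg_sub S.

Section ScaleMap.
Variables (R : pzRingType) (V : lmodType R) (v : V).

Fact scale_map_linear : linear (fun a : R^o => (a : R) *: v).
Proof. by move=> a x y; rewrite scalerDl scalerA. Qed.

Definition scale_map : {linear R^o -> V} := mkLinear scale_map_linear.

Definition cyclic : submodule V := sub_image scale_map (full_sub R^o).

Lemma cyclicP x : cyclic x <-> exists a : R, x = a *: v.
Proof.
by split=> [[a _ <-]|[a ->]]; [exists a | exists (a : R^o)].
Qed.

End ScaleMap.

Lemma left_artinian_min (R : pzRingType) :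
  left_artinian R -> artinian_module (R^o : lmodType R).
Proof.
move=> dcc F [S0 FS0]; apply: contrapT => nomin.
have /choice[next nextP] : forall S : {S | F S}, exists T : {S | F S},
    sub_le (sval T) (sval S) /\ ~ sub_le (sval S) (sval T).
  move=> [S FS]; apply: contrapT => noT; apply: nomin; exists S => // T FT TS.
  by apply: contrapT => ST; apply: noT; exists (exist _ T FT).
pose I n := sval (iter n next (exist _ S0 FS0)).
have [n|n x /asboolP|N IN] := dcc (fun n => sub_pred (I n)).
- exact: sub_pred_submod.
- have [le _] := nextP (iter n next (exist _ S0 FS0)).
  by move=> Ix; apply/asboolP; exact: le.
have [_] := nextP (iter N next (exist _ S0 FS0)); apply => x Ix.
have := IN N.+1 (leqnSn N) x; rewrite /in_mem /= /sub_pred => E.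
by apply/asboolP; rewrite -[X in is_true X]/(`[< I N.+1 x >]) E; apply/asboolP.
Qed.

(** Minimize the image first and the trace on the kernel next; by modularity
    the result is minimal. *)
Lemma artinian_ext (R : pzRingType) (K V W : lmodType R)
    (i : {linear K -> V}) (f : {linear V -> W}) :
  (forall x, f x = 0 -> exists y, i y = x) ->
  artinian_module K -> artinian_module W -> artinian_module V.
Proof.
move=> ex artK artW F [S0 FS0].
have [|_ [S1 [FS1 ->]] min1] :=
    artW (fun T => exists S, F S /\ T = sub_image f S).
  by exists (sub_image f S0), S0; split.
have [|_ [S2 [FS2 S21 ->]] min2] :=
    artK (fun U => exists S, [/\ F S, sub_le (sub_image f S) (sub_image f S1)
                               & U = sub_preimage i S]).
  by exists (sub_preimage i S1), S1; split.
exists S2 => // T FT TS2 x S2x.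
have TS1 : sub_le (sub_image f T) (sub_image f S1).
  by move=> y [z Tz <-]; apply: S21; exists z => //; exact: TS2.
have [y Ty fy] : sub_image f T (f x).
  by apply: (min1 _ _ TS1); [exists T|apply: S21; exists x].
have [|z zE] := ex (x - y); first by rewrite linearB fy subrr.
rewrite -(subrK y x) -zE; apply: sub_memD => //.
apply: (min2 (sub_preimage i T)) => [|u|]; first by exists T.
- exact: TS2.
- by rewrite /= zE; apply: sub_memB => //; exact: TS2.
Qed.

Lemma artinian_surj (R : pzRingType) (V W : lmodType R) (f : {linear V -> W}) :
  surjective_map f -> artinian_module V -> artinian_module W.
Proof.
move=> fs artV F [S0 FS0].
have [|_ [S [FS ->]] min] :=
    artV (fun T => exists S, F S /\ T = sub_preimage f S).
  by exists (sub_preimage f S0), S0; split.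
exists S => // T FT TS y; have [x <-] := fs y.
by apply: (min (sub_preimage f T)); [exists T|move=> z; exact: TS].
Qed.

Lemma fg_sub_sum (R : pzRingType) (V : lmodType R) (S T U : submodule V) :
  fg_sub S -> fg_sub T ->
  (forall x, U x <-> exists y z, [/\ S y, T z & x = y + z]) -> fg_sub U.
Proof.
move=> [n [p pP]] [m [q qP]] UE.
have rL : linear (fun x : 'rV[R]_(n + m) => p (lsubmx x) + q (rsubmx x)).
  by move=> a x y; rewrite !linearP scalerDr addrACA.
exists (n + m)%N, (mkLinear rL) => x; rewrite UE.
split=> [[y [z [/pP[s <-] /qP[t <-] ->]]]|[s <-]].
  by exists (row_mx s t); rewrite mkLinearE row_mxKl row_mxKr.
exists (p (lsubmx s)), (q (rsubmx s)).
by split=> //; [apply/pP; exists (lsubmx s)|apply/qP; exists (rsubmx s)].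
Qed.

Lemma fg_sub_image (R : pzRingType) (V W : lmodType R) (f : {linear V -> W})
    (S : submodule V) (T : submodule W) :
  (forall x, T x <-> exists2 y, S y & f y = x) -> fg_sub S -> fg_sub T.
Proof.
move=> TE [n [p pP]]; exists n, (f \o p) => x; rewrite TE.
split=> [[y /pP[z <-] <-]|[z <-]]; first by exists z.
by exists (p z) => //; apply/pP; exists z.
Qed.

Lemma fg_sub_cyclic (R : pzRingType) (V : lmodType R) (v : V) :
  fg_sub (cyclic v).
Proof.
exists 1%N, (comb (fun=> v)) => x; rewrite cyclicP; split=> [[a ->]|[y <-]].
  by exists a%:M; rewrite combE big_ord1 mxE.
by exists (y 0 0); rewrite combE big_ord1.
Qed.

(** Lift generators of the image and add generators of the trace on the
    kernel. *)
Lemma fg_sub_ext (R : pzRingType) (V W : lmodType R) (f : {linear V -> W})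
    (S : submodule V) :
  fg_sub (sub_image f S) -> fg_sub (sub_cap S (sub_ker f)) -> fg_sub S.
Proof.
move=> [n [p pP]] fgK.
have /choice[g gP] : forall j : 'I_n, exists v, S v /\ f v = p 'e_j.
  move=> j; have /pP[v Sv fv] : exists y, p y = p 'e_j by exists 'e_j.
  by exists v.
have fg x : f (comb g x) = p x.
  apply: (eq_on_delta (f := f \o comb g)) => j /=.
  by rewrite comb_delta; case: (gP j).
have Sg x : S (comb g x).
  by apply: sub_mem_sum => j _; apply: sub_memZ; case: (gP j).
apply: (fg_sub_sum (S := sub_image (comb g) (full_sub _)) _ fgK) => [|x].
  by exists n, (comb g) => x; split=> [[y _ <-]|[y <-]]; exists y.
split=> [Sx|[_ [z [[y _ <-] [Sz _] ->]]]]; last exact: sub_memD.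
have /pP[y yE] : sub_image f S (f x) by exists x.
exists (comb g y), (x - comb g y); split; first by exists y.
  by split; [exact: sub_memB|rewrite /= linearB fg yE subrr].
by rewrite addrC subrK.
Qed.

Lemma noetherian_ext (R : pzRingType) (K V W : lmodType R)
    (i : {linear K -> V}) (f : {linear V -> W}) :
  (forall x, f x = 0 <-> exists y, i y = x) ->
  noetherian_module K -> noetherian_module W -> noetherian_module V.
Proof.
move=> ex noethK noethW S; apply: (fg_sub_ext (f := f)); first exact: noethW.
apply: (fg_sub_image (f := i) _ (noethK (sub_preimage i S))) => x /=.
split=> [[Sx /ex[y yE]]|[y Sy <-]]; first by exists y; rewrite //= yE.
by split=> //; apply/ex; exists y.
Qed.

Section RowModule.
Variables (R : pzRingType) (n : nat).

Fact tail_linear :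
  linear (fun x : 'rV[R]_n.+1 => \row_j x 0 (lift ord0 j)).
Proof. by move=> a x y; apply/rowP => j; rewrite !mxE. Qed.

Lemma head_tail_exact (x : 'rV[R]_n.+1) :
  mkLinear tail_linear x = 0 <-> exists a, scale_map 'e_0 a = x.
Proof.
rewrite mkLinearE; split=> [/rowP x0|[a <-]]; last first.
  by apply/rowP => j; rewrite !mxE /= mulr0.
exists (x 0 0); apply/rowP => j; rewrite mkLinearE !mxE /=.
case: (unliftP ord0 j) => [k|] ->; last by rewrite eqxx mulr1.
by have := x0 k; rewrite !mxE /= mulr0 => ->.
Qed.

End RowModule.

(** The free module of rank [n + 1] is an extension of that of rank [n] by
    the ring, so any property inherited by extensions passes from the ring
    to all of them. *)
Lemma row_module_ind (R : pzRingType) (C : lmodType R -> Prop) :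
  (forall V : lmodType R, (forall x : V, x = 0) -> C V) ->
  (forall (K V W : lmodType R) (i : {linear K -> V}) (f : {linear V -> W}),
     (forall x, f x = 0 <-> exists y, i y = x) -> C K -> C W -> C V) ->
  C R^o -> forall n, C 'rV[R]_n.
Proof.
move=> C0 Cext CR; elim=> [|n IH].
  by apply: C0 => x; apply/rowP => -[].
exact: Cext (@head_tail_exact R n) CR IH.
Qed.

Lemma artinian_row (R : pzRingType) n :
  artinian_module (R^o : lmodType R) -> artinian_module 'rV[R]_n.
Proof.
move=> artR; apply: (@row_module_ind R (@artinian_module R)) => //.
  by move=> V V0 F [S FS]; exists S => // T FT _ x; rewrite (V0 x) => _;
    exact: sub_mem0.
move=> K V W i f ex aK aW; apply: (artinian_ext (i := i) (f := f)) => // x.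
by move=> /ex.
Qed.

Lemma noetherian_row (R : pzRingType) n :
  noetherian_module (R^o : lmodType R) -> noetherian_module 'rV[R]_n.
Proof.
move=> noethR; apply: (@row_module_ind R (@noetherian_module R)) => //.
  move=> V V0 S; exists 0%N, (GRing.null_fun _) => x; rewrite (V0 x).
  by split=> _; [exists 0|exact: sub_mem0].
by move=> K V W i f ex; exact: (noetherian_ext ex).
Qed.

Lemma fg_sub_carrier (R : pzRingType) (V : lmodType R) (S : submodule V) :
  fg_sub S -> finitely_generated (carrier S).
Proof.
move=> [n [p pP]]; have Sp x : S (p x) by apply/pP; exists x.
apply: (cover_fg (p := cores Sp)) => y.
have /pP[x xE] := inclP y; exists x; apply: incl_inj.
by rewrite incl_cores.
Qed.

(** Zorn's lemma; for [x = 1] in the regular module it provides maximal left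
    ideals. *)
Lemma maximal_avoiding (R : pzRingType) (V : lmodType R) (S : submodule V) x :
  ~ S x -> exists H : submodule V, [/\ sub_le S H, ~ H x
    & forall T, sub_le H T -> ~ T x -> sub_le T H].
Proof.
move=> Sx.
pose Q (A : classical_sets.set V) := exists H : submodule V,
  [/\ sub_le S H, ~ H x & forall y, H y <-> S y \/ A y].
have [F QF totF|A [[H [SH Hx HA]] Amax]] :=
  @classical_sets.Zorn_bigcup V Q; last first.
  exists H; split=> // T HT Tx.
  apply: contrapT => TH.
  apply: (Amax T); last first.
    exists T; split=> // [y /SH /HT //|y].
    by split=> [|[/SH /HT|]] //; right.
  split=> [y Ay|TA]; first by apply/HT/HA; right.
  by apply: TH => y /TA Ay; apply/HA; right.
pose U y := S y \/ exists2 A, F A & A y.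
have U0 : U 0 by left; exact: sub_mem0.
(* two members of the union lie in one submodule of the chain *)
have U2 y z : U y -> U z ->
    exists2 H : submodule V, H y /\ H z & forall t, H t -> U t.
  have HU A (H : submodule V) : F A -> (forall t, H t <-> S t \/ A t) ->
      forall t, H t -> U t.
    by move=> FA HA t /HA[St|At]; [left|right; exists A].
  move=> [Sy|[A FA Ay]] [Sz|[B FB Bz]].
  - by exists S => // t; left.
  - have [H [SH _ HB]] := QF _ FB.
    by exists H; [split; [exact: SH|apply/HB; right]|exact: HU FB HB].
  - have [H [SH _ HA]] := QF _ FA.
    by exists H; [split; [apply/HA; right|exact: SH]|exact: HU FA HA].
  - have [H [SH _ HA]] := QF _ FA; have [G [SG _ GB]] := QF _ FB.
    have [AB|BA] := totF _ _ FA FB.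
      by exists G; [split; apply/GB; right; [exact: AB|]|exact: HU FB GB].
    by exists H; [split; apply/HA; right; [|exact: BA]|exact: HU FA HA].
have UZD a y z : U y -> U z -> U (a *: y + z).
  move=> Uy Uz; have [H [Hy Hz] HU] := U2 y z Uy Uz.
  by apply: HU; exact: sub_memZD.
exists (Submodule U0 UZD); split=> [y Sy|[//|[A FA Ax]]|y]; first by left.
- by have [H [_ Hx HA]] := QF _ FA; apply: Hx; apply/HA; right.
- by split=> -[Sy|[A FA Ay]]; [left|right; exists A|left|right; exists A].
Qed.

(** Over a commutative artinian ring the minimum condition implies that all
    submodules are finitely generated.  A minimal counterexample [K] cannot be
    an extension of two smaller modules, so every scalar either kills [K] or
    maps it onto itself, and the chain of powers then makes it invertible on
    [K].  Thus [K] is a vector space, and a complement of a line is a smaller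
    submodule that generates [K] together with one vector. *)
Lemma comm_artinian_noetherian (R : pzRingType) (V : lmodType R) :
  (forall a b : R, a * b = b * a) -> artinian_module (R^o : lmodType R) ->
  artinian_module V -> noetherian_module V.
Proof.
move=> mulC artR artV S; apply: contrapT => nfgS.
have [|K nfgK Kmin] := artV (fun S => ~ fg_sub S); first by exists S.
have small T : sub_le T K -> ~ sub_le K T -> fg_sub T.
  by move=> TK KT; apply: contrapT => nfgT; apply: KT; exact: Kmin.
have muL r : linear (fun x : V => r *: x).
  by move=> a x y; rewrite scalerDr !scalerA mulC.
have kill_or_onto r : (forall x, K x -> r *: x = 0) \/
    (forall x, K x -> exists2 y, K y & r *: y = x).
  have [|nonto] := pselect (sub_le K (sub_image (mkLinear (muL r)) K)).
    by move=> onto; right=> x /onto[y]; exists y.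
  left; apply: contrapT => nkill; apply: nfgK.
  apply: (fg_sub_ext (f := mkLinear (muL r))).
    by apply: small => // x [y Ky <-]; exact: sub_memZ.
  apply: small => [x []//|le]; apply: nkill => x Kx.
  by have [] := le x Kx.
have kill_or_inv r : (forall x, K x -> r *: x = 0) \/
    exists b, forall x, K x -> (b * r) *: x = x.
  have [?|onto] := kill_or_onto r; [by left|right].
  have [|_ [n ->] minn] :=
      artR (fun T => exists n, T = cyclic (r ^+ n : R^o)).
    by exists (cyclic (r ^+ 0 : R^o)), 0%N.
  have : cyclic (r ^+ n.+1 : R^o) (r ^+ n).
    apply: minn; first by exists n.+1.
      move=> x /cyclicP[a ->]; apply/cyclicP; exists (a * r).
      by rewrite exprS /GRing.scale /= mulrA.
    by apply/cyclicP; exists 1; rewrite scale1r.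
  move=> /cyclicP[b bE]; exists b => x Kx.
  have [y Ky <-] : exists2 y, K y & r ^+ n *: y = x.
    elim: {bE minn} n x Kx => [|n IH] x Kx; first by exists x; rewrite ?scale1r.
    have [z Kz <-] := onto x Kx; have [y Ky <-] := IH z Kz.
    by exists y; rewrite // exprS scalerA.
  by rewrite scalerA -mulrA -exprS [in RHS]bE.
have [x [Kx x0]] : exists x, K x /\ x <> 0.
  apply: contrapT => nox; apply: nfgK; exists 0%N, (GRing.null_fun _) => x.
  split=> [Kx|[y <-]]; last exact: sub_mem0.
  by exists 0; apply: contrapT => /= nx; apply: nox; exists x; split=> // /esym.
have [H [_ Hx Hmax]] := @maximal_avoiding _ _ (zero_sub V) x x0.
apply: nfgK; apply: (@fg_sub_sum _ _ (sub_cap K H) (cyclic x)).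
- by apply: small => [y []//|KH]; apply: Hx; case: (KH x Kx).
- exact: fg_sub_cyclic.
move=> y; split=> [Ky|[h [_ [[Kh _] /cyclicP[c ->] ->]]]]; last first.
  by apply: sub_memD => //; exact: sub_memZ.
have [Hy|nHy] := pselect (H y).
  exists y, 0; split=> //; last by rewrite addr0.
  by apply/cyclicP; exists 0; rewrite scale0r.
have [h Hh /cyclicP[c xE]] : sub_sum H (cyclic y) x.
  apply: contrapT => nx; apply: nHy; apply: (Hmax (sub_sum H (cyclic y))) => //.
    by move=> z Hz; exists z => //; rewrite subrr; exact: sub_mem0.
  exists 0; first exact: sub_mem0.
  by apply/cyclicP; exists 1; rewrite subr0 scale1r.
have [c0|[b bP]] := kill_or_inv c.
  by case: Hx; rewrite -(subrK h x) xE c0 ?add0r.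
have yE : y = - (b *: h) + b *: x.
  by rewrite addrC -scalerBr xE scalerA bP.
exists (- (b *: h)), (b *: x); split=> //; last by apply/cyclicP; exists b.
split; last by apply/sub_memN/sub_memZ.
have -> : - (b *: h) = y - b *: x by rewrite {1}yE addrK.
by apply: sub_memB => //; exact: sub_memZ.
Qed.

(** Modules obtained by restriction along a map from [k] are modules over
    the converse of [k]. *)
Lemma left_artinian_conv (k : comPzRingType) :
  left_artinian k -> left_artinian k^c.
Proof.
move=> art I Iid Isub; apply: (art I) => // n.
have [I0 IZD] := Iid n; split=> // a x y Ix Iy.
have -> : a *: x + y = (a : k^c) *: (x : k^c^o) + (y : k^c^o).
  by congr (_ + _); exact: mulrC.
exact: IZD.
Qed.

Section RestrictSubmodule.
Variables (k : comPzRingType) (A : pzRingType) (s : {rmorphism k -> A}).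
Hypothesis sC : forall c x, s c * x = x * s c.
Variable S : submodule (A^o : lmodType A).

Fact restr_sub_memZD (a : k^c) (x y : restr s) :
  S x -> S y -> S (a *: x + y).
Proof.
move=> Sx Sy; have -> : a *: x + y = s a *: (x : A^o) + (y : A^o) :> A.
  by congr (_ + _); rewrite /GRing.scale /= /restr_scale sC.
exact: sub_memZD.
Qed.

Definition restr_sub : submodule (right_restriction s) :=
  @Submodule k^c (restr s) S (sub_mem0 S) restr_sub_memZD.

End RestrictSubmodule.

(** Left ideals are subspaces over the commutative base, where finitely
    generated modules satisfy both chain conditions. *)
Lemma artin_algebra_chain (A : pzRingType) : artin_algebra A ->
  artinian_module (A^o : lmodType A) /\ noetherian_module (A^o : lmodType A).
Proof.
move=> [k [s [art sC fgA]]].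
have artk := left_artinian_min (left_artinian_conv art).
have [n [p ps]] := fg_cover fgA.
have artA := artinian_surj ps (@artinian_row _ n artk).
have kC (a b : k^c) : a * b = b * a by exact: mulrC.
have noethA := comm_artinian_noetherian kC artk artA.
split=> [F [S0 FS0]|S].
  have [|_ [S [FS ->]] min] :=
      artA (fun T => exists S, F S /\ T = restr_sub sC S).
    by exists (restr_sub sC S0), S0; split.
  by exists S => // T FT TS x Sx; apply: (min (restr_sub sC T)) => //; exists T.
have [m [q qP]] := noethA (restr_sub sC S).
exists m, (comb (fun j => q 'e_j : A^o)) => x.
split=> [/qP[y <-]|[y <-]]; last first.
  apply: sub_mem_sum => j _; apply: sub_memZ.
  by apply/(qP (q 'e_j)); exists 'e_j.
exists (\row_j s (y 0 j)); rewrite combE {2}[y]row_sum_delta linear_sum.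
apply: eq_bigr => j _; rewrite mxE linearZ.
exact: sC.
Qed.

(** * The Jacobson radical of a left artinian ring *)

Definition nilpotent_elt (R : pzRingType) (x : R) : Prop :=
  exists n, x ^+ n = 0.

Lemma nilpotent_swap (R : pzRingType) (x y : R) :
  nilpotent_elt (x * y) -> nilpotent_elt (y * x).
Proof.
move=> [n xy0]; exists n.+1.
suff -> : (y * x) ^+ n.+1 = y * (x * y) ^+ n * x by rewrite xy0 mulr0 mul0r.
elim: n {xy0} => [|n IH]; first by rewrite mulr1.
by rewrite exprS IH [in RHS]exprS !mulrA.
Qed.

Lemma jacobson_max (R : pzRingType) (x : R) (H : submodule (R^o : lmodType R)) :
  jacobson x -> ~ H 1 ->
  (forall T : submodule R^o, sub_le H T -> ~ T 1 -> sub_le T H) -> H x.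
Proof.
move=> Jx H1 Hmax; apply/asboolP; apply: (Jx (sub_pred H)); split.
- exact: sub_pred_submod.
- by apply/negP => /asboolP.
move=> J Jid J1 HJ y.
have [J0 JZD] := Jid.
pose T : submodule (R^o : lmodType R) :=
  @Submodule R R^o (fun x => x \in J) J0 JZD.
apply/idP/asboolP => [|Hy]; last by apply: HJ; apply/asboolP.
apply: (Hmax T) => [z Hz|]; last by exact/negP.
by apply: HJ; apply/asboolP.
Qed.

Lemma jacobson_intro (R : pzRingType) (x : R) :
  (forall H : submodule (R^o : lmodType R), ~ H 1 ->
    (forall T : submodule R^o, sub_le H T -> ~ T 1 -> sub_le T H) -> H x) ->
  jacobson x.
Proof.
move=> Hx I [[I0 IZD] I1 Imax].
pose H : submodule (R^o : lmodType R) :=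
  @Submodule R R^o (fun x => x \in I) I0 IZD.
apply: (Hx H) => [|T HT T1]; first exact/negP.
have TI : sub_pred T =i I.
  apply: Imax => [||z /HT ?]; [exact: sub_pred_submod| |exact/asboolP].
  by apply/negP => /asboolP.
by move=> z Tz; rewrite /= -TI; apply/asboolP.
Qed.

Fact jacobson0 (R : pzRingType) : jacobson (0 : R).
Proof. by move=> I [[]]. Qed.

Fact jacobsonZD (R : pzRingType) (a x y : R) :
  jacobson x -> jacobson y -> jacobson (a * x + y).
Proof.
by move=> Jx Jy I Imax; have [[_ IZD] _ _] := Imax; apply: IZD; auto.
Qed.

Definition rad (R : pzRingType) : submodule (R^o : lmodType R) :=
  @Submodule R R^o (@jacobson R) (@jacobson0 R) (@jacobsonZD R).

Lemma jacobson_mull (R : pzRingType) (a x : R) : jacobson x -> jacobson (a * x).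
Proof. exact: (@sub_memZ _ _ (rad R)). Qed.

(** Otherwise [1 - x] lies in a maximal left ideal, which contains [x],
    hence 1. *)
Lemma jacobson_left_inv (R : pzRingType) (x : R) :
  jacobson x -> exists v, v * (1 - x) = 1.
Proof.
move=> Jx; have [/cyclicP[v vE]|no1] := pselect (cyclic (1 - x : R^o) 1).
  by exists v.
have [H [cH H1 Hmax]] := maximal_avoiding no1.
case: (H1); rewrite -(subrK x 1); apply: sub_memD.
  by apply/cH/cyclicP; exists 1; rewrite scale1r.
exact: jacobson_max.
Qed.

Lemma power_stable (R : pzRingType) (x : R) :
  artinian_module (R^o : lmodType R) -> exists n d, x ^+ n = d * x ^+ n.+1.
Proof.
move=> artR; have [|_ [n ->] minn] :=
    artR (fun T => exists n, T = cyclic (x ^+ n : R^o)).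
  by exists (cyclic (x ^+ 0 : R^o)), 0%N.
have /cyclicP[d dE] : cyclic (x ^+ n.+1 : R^o) (x ^+ n).
  apply: minn; first by exists n.+1.
    move=> y /cyclicP[a ->]; apply/cyclicP; exists (a * x).
    by rewrite exprS /GRing.scale /= mulrA.
  by apply/cyclicP; exists 1; rewrite scale1r.
by exists n, d.
Qed.

Section ArtinianRing.
Variable R : pzRingType.
Hypothesis artR : artinian_module (R^o : lmodType R).

(** When the powers of [x] stabilize, [x ^+ n = d * x ^+ n.+1], the factor
    [1 - d * x] annihilates [x ^+ n] and has a left inverse. *)
Lemma jacobson_nilpotent (x : R) : jacobson x -> nilpotent_elt x.
Proof.
move=> Jx; have [n [d dE]] := power_stable x artR.
have [v vE] := jacobson_left_inv (jacobson_mull d Jx).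
by exists n; rewrite -[LHS]mul1r -vE -mulrA mulrBl mul1r -mulrA -exprS -dE subrr
  mulr0.
Qed.

(** A maximal left ideal missing [x] would contain some [1 - b * x], which
    the geometric series inverts. *)
Lemma nil_jacobson (x : R) : (forall b, nilpotent_elt (b * x)) -> jacobson x.
Proof.
move=> nilx; apply: jacobson_intro => H H1 Hmax; apply: contrapT => Hx.
have [h Hh /cyclicP[b bE]] : sub_sum H (cyclic (x : R^o)) 1.
  apply: contrapT => no1; apply: Hx.
  apply: (Hmax (sub_sum H (cyclic (x : R^o)))) => //.
    by move=> z Hz; exists z => //; rewrite subrr; exact: sub_mem0.
  exists 0; first exact: sub_mem0.
  by apply/cyclicP; exists 1; rewrite subr0 scale1r.
have [n bx0] := nilx b; apply: H1.
have hE : h = 1 - b * x by rewrite -[b * x]bE opprB addrC subrK.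
have -> : 1 = (\sum_(i < n) (b * x) ^+ i) *: (h : R^o).
  rewrite -[LHS]subr0 -[X in _ - X]bx0 -opprB subrX1 -mulNr opprB -hE.
  rewrite /GRing.scale /= hE mulr_sumr mulr_suml; apply: eq_bigr => i _.
  by rewrite mulrBl mulrBr mul1r mulr1 -exprS -exprSr.
exact: sub_memZ.
Qed.

Lemma jacobson_mulr (x b : R) : jacobson x -> jacobson (x * b).
Proof.
move=> Jx; apply: nil_jacobson => c; rewrite mulrA; apply: nilpotent_swap.
by rewrite mulrA; apply/jacobson_nilpotent/jacobson_mull.
Qed.

Lemma jacobson_idem0 (f : R) : idempotent_elt f -> jacobson f -> f = 0.
Proof.
move=> ff /jacobson_nilpotent[n fn].
suff fE m : f ^+ m.+1 = f by rewrite -(fE n) exprS fn mulr0.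
by elim: m => [|m IH]; rewrite ?expr1 // exprS IH.
Qed.

(** If [u ^+ m * (1 - u) ^+ m = 0], then [1 - (1 - u ^+ m) ^+ m] is the
    idempotent polynomial in [u] congruent to 1 mod [(1 - u) ^+ m] and to 0
    mod [u ^+ m]. *)
Lemma idem_of_fitting (u : R) m : u ^+ m * (1 - u) ^+ m = 0 ->
  idempotent_elt (1 - (1 - u ^+ m) ^+ m) /\
  (1 - (1 - u ^+ m) ^+ m = 0 -> u ^+ m = 0) /\
  exists q, 1 - (1 - u ^+ m) ^+ m = q * u ^+ m.
Proof.
move=> u0; set w := u ^+ m; set f := 1 - _.
pose t := \sum_(i < m) u ^+ i.
have cut : GRing.comm (1 - u) t.
  apply: commr_sum => i _; apply/commrX/commr_sym/commrB; first exact: commr1.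
  exact: commr_refl.
have wE : 1 - w = (1 - u) * t by rewrite -opprB subrX1 -mulNr opprB.
have wy : w * (1 - w) ^+ m = 0 by rewrite wE exprMn_comm // mulrA u0 mul0r.
have fE : f = (\sum_(i < m) (1 - w) ^+ i) * w.
  rewrite /f -opprB subrX1 -mulNr opprB opprB addrC subrK.
  rewrite mulr_sumr mulr_suml; apply: eq_bigr => i _.
  apply/commrX/commrB; first exact: commr1.
  exact: commr_refl.
split; last split.
- rewrite /idempotent_elt {2}/f mulrBr mulr1 {2}fE -mulrA wy mulr0 subr0 //.
- move=> f0; have y1 : (1 - w) ^+ m = 1.
    by apply/esym/eqP; rewrite -subr_eq0; apply/eqP.
  by rewrite -wy y1 mulr1.
- by exists (\sum_(i < m) (1 - w) ^+ i).
Qed.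

(** In a left ideal that is minimal among the non-nil ones inside [R c], a
    non-nilpotent [a] satisfies [a = u a] with [u] in the ideal; then [u] is
    idempotent up to a nilpotent error, which can be corrected. *)
Lemma nonnil_idempotent (c : R) : ~ nilpotent_elt c ->
  exists f r, [/\ idempotent_elt f, f <> 0 & f = r * c].
Proof.
move=> cN.
have [|L [Lc [a La aN]] Lmin] := artR (F := fun T : submodule R^o =>
    sub_le T (cyclic (c : R^o)) /\ exists2 a, T a & ~ nilpotent_elt a).
  exists (cyclic (c : R^o)); split=> //; exists c => //.
  by apply/cyclicP; exists 1; rewrite scale1r.
have aaN : ~ nilpotent_elt (a * a).
  by move=> [n an]; apply: aN; exists (n + n)%N; rewrite exprD -exprMn_comm.
have [u Lu uE] : sub_image (scale_map (a : R^o)) L a.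
  have leL : sub_le (sub_image (scale_map (a : R^o)) L) L.
    by move=> _ [y _ <-]; exact: sub_memZ.
  apply: Lmin => //; split=> [y /leL /Lc //|]; exists (a * a) => //.
  by exists a.
have ua : u * a = a by exact: uE.
have Nnil v : L v -> v * a = 0 -> nilpotent_elt v.
  move=> Lv va; apply: contrapT => vN.
  have [||_ a0] := Lmin (sub_cap L (sub_ker (scale_map (a : R^o)))) _ _ a La.
  - by split=> [y [/Lc]|] //; exists v.
  - by move=> y [].
  by apply: aaN; exists 1%N; rewrite expr1; exact: a0.
have [||m um] := Nnil (u * u - u).
- by apply: sub_memB => //; exact: sub_memZ.
- by rewrite mulrBl -mulrA ua ua subrr.
have uma k : u ^+ k * a = a.
  by elim: k => [|k IH]; rewrite ?mul1r // exprSr -mulrA ua.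
have um0 : u ^+ m.+1 * (1 - u) ^+ m.+1 = 0.
  rewrite -exprMn_comm; last by apply/commrB; [exact: commr1|exact: commr_refl].
  have -> : u * (1 - u) = - (u * u - u) by rewrite mulrBr mulr1 opprB.
  by rewrite exprNn [X in _ * X]exprSr um mul0r mulr0.
have [ff [f0 [q qE]]] := idem_of_fitting um0.
have /Lc /cyclicP[r rE] : L (q * u ^+ m.+1).
  by rewrite exprSr mulrA; exact: sub_memZ.
eexists; exists r; split; [exact: ff| |by rewrite qE].
move=> /f0 u0; apply: aN; exists 1%N.
by rewrite expr1 -(uma m.+1) u0 mul0r.
Qed.

(** * Matrices over the radical *)

Fact rad_row_mem0 n : forall j, jacobson ((0 : 'rV[R]_n) 0 j).
Proof. by move=> j; rewrite mxE; exact: jacobson0. Qed.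

Fact rad_row_memZD n a (x y : 'rV[R]_n) :
  (forall j, jacobson (x 0 j)) -> (forall j, jacobson (y 0 j)) ->
  forall j, jacobson ((a *: x + y) 0 j).
Proof. by move=> Jx Jy j; rewrite !mxE; exact: jacobsonZD. Qed.

Definition rad_row n : submodule 'rV[R]_n :=
  Submodule (@rad_row_mem0 n) (@rad_row_memZD n).

(** Free modules are semisimple modulo the radical: a submodule [L'] minimal
    among those supplementing [L] and containing the radical meets [L] in the
    radical only. *)
Lemma complement_mod_rad n (L : submodule 'rV[R]_n) :
  exists2 L' : submodule 'rV[R]_n, forall x, sub_sum L L' x
    & forall x, L x -> L' x -> rad_row n x.
Proof.
have [|L' [LL' radL'] Lmin] := @artinian_row R n artR
  (fun T : submodule 'rV[R]_n =>
    (forall x, sub_sum L T x) /\ sub_le (rad_row n) T).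
  by exists (full_sub _); split=> // x; exists 0 => //; exact: sub_mem0.
exists L' => // x Lx L'x j; apply: jacobson_intro => H H1 Hmax.
apply: contrapT => Hx.
have [| |_ //] :=
  Lmin (sub_cap L' (sub_preimage (coord R j) H)) _ _ x L'x; last first.
  by move=> y [].
split=> [z|y Jy]; last by split; [exact: radL'|exact: (jacobson_max (Jy j))].
have [l Ll Lz] := LL' z.
have [h Hh /cyclicP[c cE]] : sub_sum H (cyclic (x 0 j : R^o)) 1.
  apply: contrapT => no1; apply: Hx.
  apply: (Hmax (sub_sum H (cyclic (x 0 j : R^o)))) => //.
    by move=> y Hy; exists y => //; rewrite subrr; exact: sub_mem0.
  exists 0; first exact: sub_mem0.
  by apply/cyclicP; exists 1; rewrite subr0 scale1r.
pose d := (z - l) 0 j * c.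
exists (l + d *: x); first by apply: sub_memD => //; exact: sub_memZ.
rewrite opprD addrA; split; first by apply: sub_memB => //; exact: sub_memZ.
have -> : sub_preimage (coord R j) H (z - l - d *: x) =
  H ((z - l - d *: x) 0 j) by [].
have -> : (z - l - d *: x) 0 j = (z - l) 0 j *: (h : R^o).
  rewrite !mxE /d -mulrA -[c * _]cE !mxE mulrBr mulr1 opprB addrC subrK.
  by [].
exact: sub_memZ.
Qed.

(** Nakayama's lemma for free modules, by eliminating one basis vector at a
    time. *)
Lemma nakayama_row n (S : submodule 'rV[R]_n) :
  (forall x, exists2 y, rad_row n y & S (x - y)) -> forall x, S x.
Proof.
move=> SJ.
suff red r : (r <= n)%N -> forall x, exists2 y,
    S (x - y) & forall j : 'I_n, (n - r <= j)%N -> y 0 j = 0.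
  move=> x; have [y Sy y0] := red n (leqnn n) x.
  suff y00 : y = 0 by rewrite y00 subr0 in Sy.
  by apply/rowP => j; rewrite y0 ?subnn // mxE.
elim: r => [|r IH] rn x.
  exists x => [|j]; first by rewrite subrr; exact: sub_mem0.
  by rewrite subn0 leqNgt ltn_ord.
have {}IH := IH (ltnW rn).
have kn : (n - r.+1 < n)%N by rewrite ltn_subrL; case: n rn {S SJ x IH}.
pose k := Ordinal kn.
have kj (j : 'I_n) : (n - r.+1 <= j)%N -> j = k \/ (n - r <= j)%N.
  rewrite leq_eqVlt => /orP[/eqP kj|]; first by left; exact: val_inj.
  by rewrite -subSn // subSS; right.
(* a radical vector congruent to 'e_k supported below n - r *)
have [y [Jy Sy y0]] : exists y, [/\ rad_row n y, S ('e_k - y)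
    & forall j : 'I_n, (n - r <= j)%N -> y 0 j = 0].
  have [y Jy Sy] := SJ 'e_k.
  have /choice[z zP] : forall i : 'I_n, exists z : 'rV[R]_n, S ('e_i - z) /\
      forall j : 'I_n, (n - r <= j)%N -> z 0 j = 0.
    by move=> i; have [z] := IH 'e_i; exists z.
  exists (comb z y); split.
  - move=> j; rewrite combE summxE; apply: (@sub_mem_sum _ _ (rad R)) => i _.
    by rewrite mxE; exact: jacobson_mulr.
  - rewrite -(subrK y 'e_k) -addrA; apply: sub_memD => //.
    rewrite {1}[y]row_sum_delta combE -sumrB; apply: sub_mem_sum => i _.
    by rewrite -scalerBr; apply: sub_memZ; case: (zP i).
  - move=> j nj; rewrite combE summxE big1 // => i _.
    by rewrite mxE (proj2 (zP i)) ?mulr0.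
have [v vE] := jacobson_left_inv (Jy k).
pose e := v *: (y - y 0 k *: 'e_k).
have Se : S ('e_k - e).
  have -> : 'e_k - e = v *: ('e_k - y).
    rewrite /e -{1}['e_k]scale1r -vE -scalerA -scalerBr scalerBl scale1r.
    by rewrite opprB addrA subrK.
  exact: sub_memZ.
have e0 (j : 'I_n) : (n - r.+1 <= j)%N -> e 0 j = 0.
  move=> /kj[->|nj]; rewrite !mxE ?eqxx ?mulr1 ?subrr ?mulr0 //.
  have -> : (j == k) = false.
    apply/negP => /eqP jk; move: nj; rewrite jk /= leqNgt ltn_sub2l //.
  by rewrite /= y0 // mulr0 subr0 mulr0.
have [x' Sx' x'0] := IH x.
exists (x' - x' 0 k *: ('e_k - e)).
  by rewrite opprB addrCA; apply: sub_memD => //; exact: sub_memZ.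
move=> j nj; have := e0 j nj; rewrite !mxE => ->; rewrite subr0.
have [->|nrj] := kj j nj; first by rewrite !eqxx mulr1 subrr.
have -> : (j == k) = false.
  apply/negP => /eqP jk; move: nrj; rewrite jk /= leqNgt ltn_sub2l //.
by rewrite /= x'0 // mulr0 subr0.
Qed.

Lemma rad_mx_left_inv n (J : 'M[R]_n) :
  (forall i j, jacobson (J i j)) -> exists W, W *m (1%:M - J) = 1%:M.
Proof.
move=> Jrad.
have surj : forall x : 'rV[R]_n, sub_image (mulmxr (1%:M - J)) (full_sub _) x.
  apply: nakayama_row => x; exists (x *m J).
    move=> j; rewrite mxE; apply: (@sub_mem_sum _ _ (rad R)) => i _.
    exact: jacobson_mull.
  by exists x => //=; rewrite mulmxBr mulmx1.
have /choice[w wP] : forall i : 'I_n, exists x : 'rV[R]_n,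
    x *m (1%:M - J) = 'e_i.
  by move=> i; have [x _ xE] := surj 'e_i; exists x.
exists (\matrix_(i, j) w i 0 j); apply/row_matrixP => i.
rewrite row_mul row1 -wP; congr (_ *m _).
by apply/rowP => j; rewrite !mxE.
Qed.

(** A left inverse of [1 - J] is again of the form 1 minus a radical matrix,
    so it has a left inverse as well. *)
Lemma rad_mx_right_inv n (J : 'M[R]_n) :
  (forall i j, jacobson (J i j)) -> exists W, (1%:M - J) *m W = 1%:M.
Proof.
move=> Jrad; have [W WE] := rad_mx_left_inv Jrad; exists W.
have WJ : W = 1%:M - - (W *m J).
  by rewrite opprK -[X in X + _]WE mulmxBr mulmx1 subrK.
have [|W' W'E] := @rad_mx_left_inv n (- (W *m J)).
  move=> i j; rewrite !mxE; apply: (@sub_memN _ _ (rad R)).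
  apply: (@sub_mem_sum _ _ (rad R)) => l _; exact: jacobson_mull.
rewrite -WJ in W'E.
have -> // : 1%:M - J = W'.
by rewrite -[LHS]mul1mx -{1}W'E -mulmxA WE mulmx1.
Qed.

End ArtinianRing.

(** * Flatness of projective right modules *)

Section FreeModule.
Variables (R : pzRingType) (T : choiceType).

Fact finite_support0 :
  exists s : seq T, forall t, t \notin s -> (0 : T -> R^o) t = 0.
Proof. by exists [::]. Qed.

Fact finite_supportZD a (f g : T -> R^o) :
  (exists s : seq T, forall t, t \notin s -> f t = 0) ->
  (exists s : seq T, forall t, t \notin s -> g t = 0) ->
  exists s : seq T, forall t, t \notin s -> (a *: f + g) t = 0.
Proof.
move=> [s fs] [r gr]; exists (s ++ r) => t.
rewrite mem_cat negb_or => /andP[ts tr].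
by rewrite [LHS]/(a *: f t + g t) fs // gr // scaler0; exact: addr0.
Qed.

(** The free module on [T], as the finitely supported functions. *)
Definition free_sub : submodule (T -> R^o : lmodType R) :=
  @Submodule R (T -> R^o : lmodType R)
    (fun f => exists s : seq T, forall t, t \notin s -> f t = 0)
    finite_support0 finite_supportZD.

Fact eval_linear t : linear (fun f : carrier free_sub => incl free_sub f t).
Proof. by move=> a f g; rewrite linearP. Qed.

Definition eval_free t : {linear carrier free_sub -> R^o} :=
  mkLinear (eval_linear t).

End FreeModule.

(** Split the surjection from the free module on all elements of [P], and keep
    the finitely many coordinates that occur. *)
Lemma local_dual_basis (R : pzRingType) (P : lmodType R) n (x : 'I_n -> P) :
  projective P -> exists m (phi : 'I_m -> {linear P -> R^o}) (y : 'I_m -> P),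
    forall i, x i = \sum_k (phi k (x i) : R) *: y k.
Proof.
move=> projP; pose F := carrier (free_sub R P).
have supp (f : F) : exists s : seq P, forall t, t \notin s -> incl _ f t = 0.
  exact: inclP f.
have /choice[s sP] := supp.
pose ev (f : F) : P := \sum_(t <- undup (s f)) (incl _ f t : R) *: t.
have evE (f : F) r : uniq r -> (forall t, t \notin r -> incl _ f t = 0) ->
    ev f = \sum_(t <- r) (incl _ f t : R) *: t.
  move=> ur fr; rewrite /ev (bigID (mem r)) [RHS](bigID (mem (undup (s f)))) /=.
  rewrite [X in _ + X]big1 ?addr0; last by move=> t /fr ->; rewrite scale0r.
  rewrite [X in _ = _ + X]big1 ?addr0; last first.
    by move=> t; rewrite mem_undup => /sP ->; rewrite scale0r.
  rewrite -big_filter -[RHS]big_filter; apply: perm_big; apply: uniq_perm.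
  - by rewrite filter_uniq ?undup_uniq.
  - by rewrite filter_uniq.
  - by move=> t; rewrite !mem_filter andbC.
have ev_linear : linear ev.
  move=> a f g; pose r := undup (s (a *: f + g) ++ s f ++ s g).
  have ur : uniq r by exact: undup_uniq.
  have inr h : {subset s h <= r} -> forall t, t \notin r -> incl _ h t = 0.
    by move=> hr t tr; apply: sP; apply: contra tr; exact: hr.
  rewrite !(evE _ r) //; try by apply: inr => t ts;
    rewrite mem_undup !mem_cat ts ?orbT.
  rewrite scaler_sumr -big_split; apply: eq_bigr => t _ /=.
  by rewrite [incl _ (a *: f + g)]linearP scalerA -scalerDl.
have delta_supp (p : P) : free_sub R P (fun t => (t == p)%:R).
  by exists [:: p] => t; rewrite inE => /negPf ->.
have ev_surj : surjective_map (mkLinear ev_linear).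
  move=> p; exists (to_carrier (delta_supp p)).
  rewrite mkLinearE (evE _ [:: p]) // => [|t].
    by rewrite big_seq1 incl_to eqxx scale1r.
  by rewrite inE incl_to => /negPf ->.
have [h hP] := projective_split projP ev_surj.
pose r := undup (flatten [seq s (h (x i)) | i <- enum 'I_n]).
exists (size r), (fun k => eval_free R (tnth (in_tuple r) k) \o h),
  (tnth (in_tuple r)) => i.
rewrite -{1}[x i]hP mkLinearE (evE _ r) ?undup_uniq //; first exact: big_tnth.
move=> t tr; apply: sP; apply: contra tr => ts.
rewrite mem_undup; apply/flattenP; exists (s (h (x i))) => //.
by apply/mapP; exists i; rewrite ?mem_enum.
Qed.

Section RightAction.
Variables (A : pzRingType) (X : lmodType A^c).

(** [X ^ a -> X ^ b], the tensor product of the right module [X] with the map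
    of free left modules given by [D]. *)
Definition ract a b (x : 'I_a -> X) (D : 'M[A]_(a, b)) (j : 'I_b) : X :=
  \sum_i (D i j : A^c) *: x i.

Lemma ractM a b c (x : 'I_a -> X) (D : 'M_(a, b)) (E : 'M_(b, c)) j :
  ract (ract x D) E j = ract x (D *m E) j.
Proof.
rewrite /ract; under eq_bigr => i _ do rewrite scaler_sumr.
rewrite exchange_big /=; apply: eq_bigr => i _.
rewrite mxE scaler_suml; apply: eq_bigr => k _.
by rewrite scalerA.
Qed.

(** The vanishing of Tor_1 between [X] and the cokernel of [D]. *)
Definition tor1_vanishes a b (D : 'M[A]_(a, b)) : Prop :=
  forall x : 'I_a -> X, (forall j, ract x D j = 0) ->
    exists m (y : 'I_m -> X) (L : 'M[A]_(m, a)),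
      L *m D = 0 /\ forall i, x i = ract y L i.

(** The coordinates of a relation in a local dual basis are relations with
    coefficients in [A]. *)
Lemma projective_flat a b (D : 'M[A]_(a, b)) :
  projective X -> tor1_vanishes D.
Proof.
move=> projX x xD; have [m [phi [y phiE]]] := local_dual_basis x projX.
exists m, y, (\matrix_(k, i) (phi k (x i) : A)); split=> [|i].
  apply/matrixP => k j; rewrite !mxE -[RHS](linear0 (phi k)) -(xD j) linear_sum.
  by apply: eq_bigr => i _; rewrite mxE linearZ.
by rewrite {1}(phiE i); apply: eq_bigr => k _; rewrite mxE.
Qed.

End RightAction.

Definition mx_exact (A : pzRingType) a b c (D2 : 'M[A]_(a, b))
    (D1 : 'M[A]_(b, c)) : Prop :=
  forall x : 'rV[A]_b, x *m D1 = 0 <-> exists y, y *m D2 = x.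

Lemma mx_exact_mul (A : pzRingType) a b c (D2 : 'M[A]_(a, b))
    (D1 : 'M[A]_(b, c)) : mx_exact D2 D1 -> D2 *m D1 = 0.
Proof.
move=> ex; apply/row_matrixP => i; rewrite row_mul row0; apply/ex.
by exists 'e_i; rewrite -rowE.
Qed.

Lemma mx_exact_lift (A : pzRingType) a b c m (D2 : 'M[A]_(a, b))
    (D1 : 'M[A]_(b, c)) (L : 'M[A]_(m, b)) :
  mx_exact D2 D1 -> L *m D1 = 0 -> exists N, N *m D2 = L.
Proof.
move=> ex LD.
have /choice[n nP] : forall i, exists y, y *m D2 = row i L.
  by move=> i; apply/ex; rewrite -row_mul LD row0.
exists (\matrix_i n i); apply/row_matrixP => i.
by rewrite row_mul rowK nP.
Qed.

(** Dimension shifting: Tor_2 of [X] is Tor_1 of its syzygy. *)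
Lemma tor_shift (A : pzRingType) (Y Q X : lmodType A^c)
    (i : {linear Y -> Q}) (p : {linear Q -> X}) a b c
    (D2 : 'M[A]_(a, b)) (D1 : 'M[A]_(b, c)) :
  ses i p -> projective Q -> mx_exact D2 D1 ->
  tor1_vanishes Y D1 -> tor1_vanishes X D2.
Proof.
move=> [iI ps ex] projQ exD torY x xD.
have pract m n (y : 'I_m -> Q) (D : 'M[A]_(m, n)) j :
    p (ract y D j) = ract (fun k => p (y k)) D j.
  by rewrite linear_sum; apply: eq_bigr => k _; rewrite linearZ.
have iract m n (y : 'I_m -> Y) (D : 'M[A]_(m, n)) j :
    i (ract y D j) = ract (fun k => i (y k)) D j.
  by rewrite linear_sum; apply: eq_bigr => k _; rewrite linearZ.
have /choice[q qP] : forall k, exists q, p q = x k by move=> k; exact: ps.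
have /choice[y yP] : forall j, exists y, i y = ract q D2 j.
  move=> j; apply/ex; rewrite pract -[RHS](xD j).
  by apply: eq_bigr => k _; rewrite qP.
have [j|m [y' [L [LD yE]]]] := torY y.
  apply: iI; rewrite iract linear0.
  have -> : ract (fun k => i (y k)) D1 j = ract (ract q D2) D1 j.
    by apply: eq_bigr => k _; rewrite yP.
  rewrite ractM mx_exact_mul // /ract big1 // => k _.
  by rewrite mxE scale0r.
have [N NE] := mx_exact_lift exD LD.
pose q' k := q k - ract (fun l => i (y' l)) N k.
have [j|m' [z [M [MD q'E]]]] := @projective_flat _ _ _ _ D2 projQ q'.
  have -> : ract q' D2 j = ract q D2 j - ract (ract (fun l => i (y' l)) N) D2 j.
    by rewrite /ract -sumrB; apply: eq_bigr => k _; rewrite scalerBr.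
  by rewrite ractM NE -yP yE iract subrr.
exists m', (fun k => p (z k)), M; split=> // k.
rewrite -pract -q'E linearB qP -iract.
have -> : p (i (ract y' N k)) = 0 by apply/ex; exists (ract y' N k).
by rewrite subr0.
Qed.

(** [D] ends an exact sequence of [d] further maps between free modules, so
    that its image is a [d]-th syzygy of a module with a presentation. *)
Fixpoint is_syzygy (A : pzRingType) d a b (D : 'M[A]_(a, b)) : Prop :=
  if d is d'.+1 then
    exists c (D' : 'M[A]_(b, c)), mx_exact D D' /\ is_syzygy d' D'
  else True.

Lemma is_syzygyS (A : pzRingType) d a b (D : 'M[A]_(a, b)) :
  is_syzygy d.+1 D -> is_syzygy d D.
Proof.
elim: d a b D => [|d IH] a b D // [c [D' [ex syz]]].
by exists c, D'; split=> //; exact: IH.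
Qed.

(** The vanishing of Tor above the projective dimension, computed from a
    resolution of the other argument. *)
Lemma tor_vanishing (A : pzRingType) d (X : lmodType A^c) a b
    (D : 'M[A]_(a, b)) :
  pdim_le d X -> is_syzygy d D -> tor1_vanishes X D.
Proof.
elim: d X a b D => [|d IH] X a b D.
  by move=> projX _; exact: projective_flat.
move=> [Q [Y [i [p [projQ ip pdY]]]]] [c [D' [ex syz]]].
exact: tor_shift ip projQ ex (IH _ _ _ _ pdY syz).
Qed.

(** * Images of matrices *)

Section RowModules.
Variable A : pzRingType.

Definition rowmod a b (D : 'M[A]_(a, b)) : lmodType A :=
  carrier (sub_image (mulmxr D) (full_sub 'rV[A]_a)).

Definition rowincl a b (D : 'M[A]_(a, b)) : {linear rowmod D -> 'rV[A]_b} :=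
  incl (sub_image (mulmxr D) (full_sub 'rV[A]_a)).

Fact rowmod_mem a b (D : 'M[A]_(a, b)) x :
  sub_image (mulmxr D) (full_sub 'rV[A]_a) (mulmxr D x).
Proof. by exists x. Qed.

Definition onto_rowmod a b (D : 'M[A]_(a, b)) : {linear 'rV[A]_a -> rowmod D} :=
  cores (rowmod_mem D).

Lemma rowincl_onto a b (D : 'M[A]_(a, b)) x :
  rowincl D (onto_rowmod D x) = x *m D.
Proof. exact: incl_cores. Qed.

Lemma onto_rowmod_surj a b (D : 'M[A]_(a, b)) : surjective_map (onto_rowmod D).
Proof.
move=> y; have [x _ xE] := inclP y; exists x.
by apply: incl_inj; rewrite -xE; exact: rowincl_onto.
Qed.

Lemma rowmod_fg a b (D : 'M[A]_(a, b)) : finitely_generated (rowmod D).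
Proof. exact: cover_fg (onto_rowmod_surj (D := D)). Qed.

Lemma rowmod_ses a b c (D2 : 'M[A]_(a, b)) (D1 : 'M[A]_(b, c)) :
  mx_exact D2 D1 -> ses (rowincl D2) (onto_rowmod D1).
Proof.
move=> ex; split; [exact: incl_inj|exact: onto_rowmod_surj|move=> x].
have -> : onto_rowmod D1 x = 0 <-> x *m D1 = 0.
  rewrite -rowincl_onto; split=> [->|x0]; first by rewrite linear0.
  by apply: (@incl_inj _ _ (sub_image _ _)); rewrite linear0.
rewrite ex; split=> [[y <-]|[y <-]].
  by exists (onto_rowmod D2 y); rewrite rowincl_onto.
have [z <-] := onto_rowmod_surj y.
by exists z; rewrite rowincl_onto.
Qed.

Lemma linear_matrix m n (p : {linear 'rV[A]_m -> 'rV[A]_n}) :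
  exists D, forall x, p x = x *m D.
Proof.
exists (\matrix_i p 'e_i).
by apply: (eq_on_delta (g := mulmxr _)) => j /=; rewrite -rowE rowK.
Qed.

Lemma kernel_cover a b (D : 'M[A]_(a, b)) :
  noetherian_module (A^o : lmodType A) ->
  exists c (D' : 'M[A]_(c, a)), mx_exact D' D.
Proof.
move=> noethA.
have [n [p pP]] := @noetherian_row A a noethA (sub_ker (mulmxr D)).
have [D' D'E] := linear_matrix p.
exists n, D' => x; apply: iff_trans (pP x) _.
by split=> -[y <-]; exists y; rewrite D'E.
Qed.

(** The image of [D] is projective if and only if the kernel of [D] has a
    complement; [E] projects onto such a complement along the kernel. *)
Definition splits_kernel a b (D : 'M[A]_(a, b)) (E : 'M[A]_a) : Prop :=
  E *m D = D /\ forall x : 'rV[A]_a, x *m D = 0 -> x *m E = 0.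

Lemma splits_kernel_mx a b (D : 'M[A]_(a, b)) E m (x : 'M[A]_(m, a)) :
  splits_kernel D E -> x *m D = 0 -> x *m E = 0.
Proof.
move=> [_ kerE] xD; apply/row_matrixP => i; rewrite row_mul row0.
by apply: kerE; rewrite -row_mul xD row0.
Qed.

Lemma splits_kernel_idem a b (D : 'M[A]_(a, b)) E :
  splits_kernel D E -> E *m E = E.
Proof.
move=> DE; have [ED _] := DE.
have : (E - 1%:M) *m E = 0.
  by apply: splits_kernel_mx DE _; rewrite mulmxBl mul1mx ED subrr.
by rewrite mulmxBl mul1mx => /eqP; rewrite subr_eq0 => /eqP.
Qed.

Lemma projective_splits_kernel a b (D : 'M[A]_(a, b)) :
  projective (rowmod D) -> exists E, splits_kernel D E.
Proof.
move=> projD; have [s sP] := projective_split projD (onto_rowmod_surj (D := D)).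
have [E EE] := linear_matrix (s \o onto_rowmod D); exists E; split=> [|x xD].
  apply/row_matrixP => i; rewrite row_mul [row i E]rowE -EE /=.
  by rewrite -rowincl_onto sP rowincl_onto -rowE.
rewrite -EE /=; suff -> : onto_rowmod D x = 0 by rewrite linear0.
by apply: incl_inj; rewrite [LHS]rowincl_onto xD linear0.
Qed.

Lemma splits_kernel_projective a b (D : 'M[A]_(a, b)) E :
  splits_kernel D E -> projective (rowmod D).
Proof.
move=> [ED kerE].
have /choice[g gP] : forall y : rowmod D, exists x, onto_rowmod D x = y.
  exact: onto_rowmod_surj.
have gE x y : onto_rowmod D x = onto_rowmod D y -> x *m E = y *m E.
  move=> /(congr1 (rowincl D)); rewrite !rowincl_onto => xy.
  apply/eqP; rewrite -subr_eq0 -mulmxBl; apply/eqP/kerE.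
  by rewrite mulmxBl xy subrr.
have hL : linear (fun y => g y *m E).
  move=> c x y; rewrite scalemxAl -mulmxDl; apply: gE.
  by rewrite gP linearP !gP.
apply: (retract_projective (i := mkLinear hL) (p := onto_rowmod D)).
  move=> y; rewrite mkLinearE; apply: (@incl_inj _ _ (sub_image _ _)).
  rewrite [LHS]rowincl_onto -mulmxA ED -[in RHS](gP y).
  exact/esym/rowincl_onto.
exact: row_projective.
Qed.

Lemma splits_kernel_regular a b c (D2 : 'M[A]_(a, b)) (D1 : 'M[A]_(b, c)) E :
  mx_exact D2 D1 -> splits_kernel D1 E -> exists G, D2 *m G *m D2 = D2.
Proof.
move=> ex [ED kerE].
have [|G GE] := mx_exact_lift (L := 1%:M - E) ex.
  by rewrite mulmxBl mul1mx ED subrr.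
exists G; rewrite -mulmxA GE mulmxBr mulmx1.
suff -> : D2 *m E = 0 by rewrite subr0.
by apply: (splits_kernel_mx (D := D1)) (mx_exact_mul ex).
Qed.

Lemma regular_splits_kernel a b c (D2 : 'M[A]_(a, b)) (D1 : 'M[A]_(b, c)) G :
  mx_exact D2 D1 -> D2 *m G *m D2 = D2 -> splits_kernel D1 (1%:M - G *m D2).
Proof.
move=> ex GE; split=> [|x /ex[y <-]].
  by rewrite mulmxBl mul1mx -mulmxA (mx_exact_mul ex) mulmx0 subr0.
by rewrite mulmxBr mulmx1 mulmxA -[_ *m D2 *m G]mulmxA -mulmxA GE subrr.
Qed.

End RowModules.

(** * Change of rings *)

Section ChangeOfRings.
Variables (A B : pzRingType) (phi : {rmorphism A -> B}) (d : nat).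
Hypothesis pdB : pdim_le d (right_restriction phi).

Local Notation "D ^phi" := (map_mx phi D) (at level 2, format "D ^phi").

(** The vanishing of Tor against [B], restated for matrices so that it
    combines with splittings and exactness. *)
Lemma change_rings_tor a b (D : 'M[A]_(a, b)) (x : 'rV[B]_a) :
  is_syzygy d D -> x *m D^phi = 0 ->
  exists m (y : 'rV[B]_m) (L : 'M[A]_(m, a)), L *m D = 0 /\ x = y *m L^phi.
Proof.
move=> syz xD.
have ractE m n (y : 'rV[B]_m) (N : 'M[A]_(m, n)) j :
    ract (fun i => y 0 i : right_restriction phi) N j = (y *m N^phi) 0 j.
  by rewrite mxE; apply: eq_bigr => i _; rewrite mxE.
have [j|m [y [L [LD xE]]]] := tor_vanishing pdB syz (x := fun i => x 0 i).
  by rewrite ractE xD mxE.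
exists m, (\row_k y k), L; split=> //; apply/rowP => j.
rewrite -ractE [LHS]xE; apply: eq_bigr => k _.
by rewrite mxE.
Qed.

Lemma change_rings_exact a b c (D2 : 'M[A]_(a, b)) (D1 : 'M[A]_(b, c)) :
  is_syzygy d D1 -> mx_exact D2 D1 -> mx_exact D2^phi D1^phi.
Proof.
move=> syz ex x; split=> [|[y <-]]; last first.
  by rewrite -mulmxA -map_mxM (mx_exact_mul ex) map_mx0 mulmx0.
move=> /(change_rings_tor syz)[m [y [L [LD ->]]]].
have [N <-] := mx_exact_lift ex LD.
by exists (y *m N^phi); rewrite map_mxM mulmxA.
Qed.

Lemma change_rings_splits a b (D : 'M[A]_(a, b)) E :
  is_syzygy d D -> splits_kernel D E -> splits_kernel D^phi E^phi.
Proof.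
move=> syz DE; have [ED _] := DE; split; first by rewrite -map_mxM ED.
move=> x /(change_rings_tor syz)[m [y [L [LD ->]]]].
by rewrite -mulmxA -map_mxM (splits_kernel_mx DE LD) map_mx0 mulmx0.
Qed.

Hypothesis noethA : noetherian_module (A^o : lmodType A).

(** A free resolution of a high syzygy stays exact after applying [phi], and
    the projective last syzygy stays projective because its splitting matrix
    is mapped to a splitting matrix. *)
Lemma change_rings_pdim m a b (D : 'M[A]_(a, b)) :
  is_syzygy d D -> pdim_le m (rowmod D) -> pdim_le m (rowmod D^phi).
Proof.
elim: m a b D => [|m IH] a b D syz.
  move=> /projective_splits_kernel[E DE].
  exact: splits_kernel_projective (change_rings_splits syz DE).
have [c [D' ex]] := kernel_cover D noethA.
have syz' : is_syzygy d D' by apply: is_syzygyS; exists b, D.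
move=> /(pdim_le_syzygy (rowmod_ses ex) (@row_projective A a)).
move=> /(IH _ _ _ syz') pd'.
exists 'rV[B]_a, (rowmod D'^phi), (rowincl D'^phi), (onto_rowmod D^phi).
split=> //; first exact: row_projective.
exact/rowmod_ses/change_rings_exact.
Qed.

Hypothesis artA : artinian_module (A^o : lmodType A).
Hypothesis artB : artinian_module (B^o : lmodType B).
Hypothesis phi_rad : forall x, jacobson x -> jacobson (phi x).
Hypothesis rad_phi : forall x, jacobson (phi x) -> jacobson x.

(** Splitness descends along [phi]: an element that [D] maps into the radical
    is radical up to the kernel of [D], since this can be tested over [B]; a
    complement of the image modulo the radical then gives an inverse of [D] on
    the image of [E], up to a radical matrix. *)
Lemma change_rings_regular a b (D : 'M[A]_(a, b)) E G :
  is_syzygy d D -> splits_kernel D E -> D^phi *m G *m D^phi = D^phi ->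
  exists H, D *m H *m D = D.
Proof.
move=> syz DE GE; have [ED kerE] := DE; have EE := splits_kernel_idem DE.
have phiE : D^phi *m G *m E^phi = E^phi.
  apply/eqP; rewrite -subr_eq0 -{2}[E^phi]mul1mx -mulmxBl; apply/eqP.
  apply: splits_kernel_mx (change_rings_splits syz DE) _.
  by rewrite mulmxBl GE mul1mx subrr.
have radE (x : 'rV[A]_a) : rad_row A b (x *m D) -> rad_row A a (x *m E).
  move=> JxD j; apply: rad_phi.
  have -> : phi ((x *m E) 0 j) = ((x *m D)^phi *m (G *m E^phi)) 0 j.
    by rewrite map_mxM -mulmxA [D^phi *m _]mulmxA phiE -map_mxM [RHS]mxE.
  rewrite mxE; apply: (@sub_mem_sum _ _ (rad B)) => i _.
  by apply: jacobson_mulr => //; rewrite mxE; apply: phi_rad.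
have [L' LL' LcapL'] :=
  complement_mod_rad artA (sub_image (mulmxr D) (full_sub 'rV[A]_a)).
have /choice[h hP] : forall i : 'I_b, exists h : 'rV[A]_a, L' ('e_i - h *m D).
  by move=> i; have [_ [y _ <-] Ly] := LL' 'e_i; exists y.
pose H : 'M[A]_(b, a) := \matrix_i h i.
pose J := (1%:M - D *m H) *m E.
have Jrad i j : jacobson (J i j).
  have -> : J i j = (row i (1%:M - D *m H) *m E) 0 j.
    by rewrite -row_mul [RHS]mxE.
  apply: radE; apply: LcapL'; first exact: rowmod_mem.
  rewrite -row_mul mulmxBl mul1mx -mulmxA -{1}[D]mulmx1 -mulmxBr row_mul.
  rewrite mulmx_sum_row; apply: sub_mem_sum => k _; apply: sub_memZ.
  by rewrite linearB /= row1 row_mul rowK.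
have EJ : E *m J = J.
  by rewrite /J mulmxA mulmxBr mulmx1 mulmxA ED !mulmxBl EE mul1mx.
have [W JW] := rad_mx_right_inv artA Jrad.
exists (H *m E *m W).
have -> : D *m (H *m E *m W) = E.
  rewrite !mulmxA.
  have -> : D *m H *m E = E *m (1%:M - J).
    by rewrite mulmxBr EJ mulmx1 /J mulmxBl mul1mx opprB addrC subrK.
  by rewrite -mulmxA JW mulmx1.
exact: ED.
Qed.

(** Induction on the length of a finite resolution over [A]: the next syzygy
    is a direct summand over [B], hence projective over [A] by induction,
    and then its inclusion splits over [A] because it splits over [B]. *)
Lemma change_rings_projective m a b (D : 'M[A]_(a, b)) :
  is_syzygy d D -> pdim_le m (rowmod D) ->
  projective (rowmod D^phi) -> projective (rowmod D).
Proof.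
elim: m a b D => [|m IH] a b D syz pdD projphi //.
have [c [D' ex]] := kernel_cover D noethA.
have syz' : is_syzygy d D' by apply: is_syzygyS; exists b, D.
have exphi := change_rings_exact syz ex.
have [E DE] := projective_splits_kernel projphi.
have [G GE] := splits_kernel_regular exphi DE.
have pd' := pdim_le_syzygy (rowmod_ses ex) (@row_projective A a) pdD.
have projphi' : projective (rowmod D'^phi).
  have [r [s [ri _ _]]] := ses_split (rowmod_ses exphi) projphi.
  by apply: retract_projective ri _; exact: row_projective.
have [E' DE'] := projective_splits_kernel (IH _ _ _ syz' pd' projphi').
have [H HE] := change_rings_regular syz' DE' GE.
exact: splits_kernel_projective (regular_splits_kernel ex HE).
Qed.

Lemma change_rings_pdim_reflect n m a b (D : 'M[A]_(a, b)) :
  is_syzygy d D -> pdim_le m (rowmod D) ->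
  pdim_le n (rowmod D^phi) -> pdim_le n (rowmod D).
Proof.
elim: n m a b D => [|n IH] m a b D syz pdD.
  exact: (change_rings_projective syz pdD).
have [c [D' ex]] := kernel_cover D noethA.
have syz' : is_syzygy d D' by apply: is_syzygyS; exists b, D.
have pdD1 := pdim_le_mono (leqnSn m) pdD.
have pd' := pdim_le_syzygy (rowmod_ses ex) (@row_projective A a) pdD1.
have exphi := change_rings_exact syz ex.
move=> /(pdim_le_syzygy (rowmod_ses exphi) (@row_projective B a)) pdphi'.
exists 'rV[A]_a, (rowmod D'), (rowincl D'), (onto_rowmod D).
split; [exact: row_projective|exact: rowmod_ses|exact: IH pd' pdphi'].
Qed.

(** After [d + 1] syzygies the module is the image of a matrix whose
    resolution stays exact over [B], where the bound [n] applies. *)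
Theorem change_rings_findim : finite_findim B -> finite_findim A.
Proof.
move=> [n fdB]; exists (n + d).+1.
have syz_bound t j m a b (D : 'M[A]_(a, b)) : (j + t = d)%N ->
    is_syzygy j D -> pdim_le m (rowmod D) -> pdim_le (n + t) (rowmod D).
  elim: t j m a b D => [|t IH] j m a b D jt syz pdD.
    rewrite !addn0 in jt *; subst j.
    apply: (change_rings_pdim_reflect syz pdD); apply/pdim_leE/fdB.
      exact: rowmod_fg.
    by exists m; exact/pdim_leE/(change_rings_pdim syz pdD).
  have [c [D' ex]] := kernel_cover D noethA.
  have pdD1 := pdim_le_mono (leqnSn m) pdD.
  have pd' := pdim_le_syzygy (rowmod_ses ex) (@row_projective A a) pdD1.
  rewrite addnS; exists 'rV[A]_a, (rowmod D'), (rowincl D'), (onto_rowmod D).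
  split; [exact: row_projective|exact: rowmod_ses|].
  apply: (IH j.+1 m _ _ _ _ _ pd'); first by rewrite addSnnS.
  by exists b, D.
move=> M /fg_cover[k [p ps]] [m /pdim_leE pdM].
apply/pdim_leE.
have [a [q qP]] := @noetherian_row A k noethA (sub_ker p).
have [D DE] := linear_matrix q.
have ip : ses (rowincl D) p.
  split=> [||x]; [exact: incl_inj|exact: ps|].
  apply: iff_trans (qP x) _; split=> [[y <-]|[y <-]].
    by exists (onto_rowmod D y); rewrite rowincl_onto DE.
  have [z <-] := onto_rowmod_surj y.
  by exists z; rewrite rowincl_onto DE.
exists 'rV[A]_k, (rowmod D), (rowincl D), p.
split=> //; first exact: row_projective.
have pdM1 := pdim_le_mono (leqnSn m) pdM.
have pdD := pdim_le_syzygy ip (@row_projective A k) pdM1.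
exact: (syz_bound d 0%N _ _ _ _ _ _ pdD).
Qed.

End ChangeOfRings.

(** * Idempotents *)

Section Idempotents.
Variable R : pzRingType.
Implicit Types e f g x y : R.

(** Two idempotents generate isomorphic left ideals iff they are equivalent in
    the sense of Murray and von Neumann. *)
Definition idem_equiv e f : Prop :=
  exists x y, [/\ x = e * x * f, y = f * y * e, x * y = e & y * x = f].

Lemma idem_equiv_refl e : idempotent_elt e -> idem_equiv e e.
Proof. by move=> ee; exists e, e; rewrite !ee. Qed.

Lemma idem_equiv_sym e f : idem_equiv e f -> idem_equiv f e.
Proof. by move=> [x [y [xE yE xy yx]]]; exists y, x. Qed.

Lemma corner_absorb e f x : idempotent_elt e -> idempotent_elt f ->
  x = e * x * f -> e * x = x /\ x * f = x.
Proof.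
by move=> ee ff xE; split; rewrite {1}xE ?mulrA ?ee -?mulrA ?ff !mulrA -xE.
Qed.

Lemma idem_equiv_trans e f g : idempotent_elt e -> idempotent_elt f ->
  idempotent_elt g -> idem_equiv e f -> idem_equiv f g -> idem_equiv e g.
Proof.
move=> ee ff gg [x [y [xE yE xy yx]]] [u [v [uE vE uv vu]]].
have [ex xf] := corner_absorb ee ff xE; have [fy ye] := corner_absorb ff ee yE.
have [fu ug] := corner_absorb ff gg uE; have [gv vf] := corner_absorb gg ff vE.
exists (x * u), (v * y); split.
- by rewrite mulrA ex -mulrA ug.
- by rewrite mulrA gv -mulrA ye.
- by rewrite mulrA -[x * u * v]mulrA uv xf.
- by rewrite mulrA -[v * y * x]mulrA yx vf.
Qed.

Fact principal_val_linear e : linear (val : principal e -> R^o).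
Proof. by []. Qed.

Definition principal_incl e : {linear principal e -> R^o} :=
  mkLinear (@principal_val_linear e).

Arguments principal_incl e : clear implicits.

Lemma principal_incl_inj e : injective (principal_incl e).
Proof. exact: val_inj. Qed.

Lemma principal_inclP e (x : principal e) :
  exists a : R, principal_incl e x = a * e.
Proof. exact/asboolP/(valP x). Qed.

Lemma principal_incl_idem e (x : principal e) : idempotent_elt e ->
  (principal_incl e x : R) * e = principal_incl e x.
Proof. by move=> ee; have [a ->] := principal_inclP x; rewrite -mulrA ee. Qed.

Definition to_principal e (x : R) (xe : x * e = x) : principal e :=
  Sub (x : R^o) (asboolT (ex_intro (fun a => x = a * e) x (esym xe))).

Lemma principal_incl_to e x (xe : x * e = x) :
  principal_incl e (to_principal xe) = x.
Proof. exact: SubK. Qed.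

Lemma idem_equiv_isomorphic e f : idempotent_elt e -> idempotent_elt f ->
  idem_equiv e f -> isomorphic (principal e) (principal f).
Proof.
move=> ee ff [x [y [xE yE xy yx]]].
have [ex xf] := corner_absorb ee ff xE; have [fy ye] := corner_absorb ff ee yE.
have mulx (r : R) : r * x * f = r * x by rewrite -mulrA xf.
have muly (r : R) : r * y * e = r * y by rewrite -mulrA ye.
have hL : linear
    (fun z : principal e => to_principal (mulx (principal_incl e z))).
  move=> a z z'; apply: principal_incl_inj.
  by rewrite [RHS]linearP !principal_incl_to linearP mulrDl -mulrA.
exists (mkLinear hL).
exists (fun z => to_principal (muly (principal_incl f z))) => z;
  apply: principal_incl_inj; rewrite !principal_incl_to -mulrA.
  by rewrite xy principal_incl_idem.
by rewrite yx principal_incl_idem.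
Qed.

(** The images of the two generators under the isomorphism and its inverse
    are the required elements. *)
Lemma isomorphic_idem_equiv e f : idempotent_elt e -> idempotent_elt f ->
  isomorphic (principal e) (principal f) -> idem_equiv e f.
Proof.
move=> ee ff [h [k hk kh]].
have kL : linear k.
  by move=> a x y; apply: (can_inj hk); rewrite kh linearP !kh.
pose k' := mkLinear kL.
pose h1 : principal e := to_principal ee.
pose k1 : principal f := to_principal ff.
have eh z : (principal_incl e z : R) *: h1 = z.
  by apply: principal_incl_inj; rewrite linearZ principal_incl_to;
    exact: principal_incl_idem.
have ek z : (principal_incl f z : R) *: k1 = z.
  by apply: principal_incl_inj; rewrite linearZ principal_incl_to;
    exact: principal_incl_idem.
pose x : R := principal_incl f (h h1); pose y : R := principal_incl e (k' k1).
have ex : e * x = x.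
  by rewrite /x -{2}(eh h1) !linearZ principal_incl_to.
have fy : f * y = y.
  by rewrite /y -{2}(ek k1) !linearZ principal_incl_to.
have xf : x * f = x by exact: principal_incl_idem.
have ye : y * e = y by exact: principal_incl_idem.
exists x, y; split; rewrite ?ex ?fy //.
- have : k' (h h1) = h1 by exact: hk.
  rewrite -(ek (h h1)) linearZ => /(congr1 (principal_incl e)).
  by rewrite linearZ principal_incl_to.
- have : h (k' k1) = k1 by exact: kh.
  rewrite -(eh (k' k1)) linearZ => /(congr1 (principal_incl f)).
  by rewrite linearZ principal_incl_to.
Qed.

(** Otherwise [e] is the sum of the orthogonal idempotents [g] and [e - g]. *)
Lemma primitive_corner e g : primitive_idempotent e -> idempotent_elt g ->
  g = e * g * e -> g <> 0 -> g = e.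
Proof.
move=> [ee _ eprim] gg gE g0; have [eg ge] := corner_absorb ee ee gE.
have [||||//|/eqP] := eprim g (e - g) gg.
- by rewrite /idempotent_elt mulrBl !mulrBr ee eg ge gg subrr subr0.
- by rewrite mulrBr ge gg subrr.
- by rewrite mulrBl eg gg subrr.
- by rewrite addrC subrK.
- by rewrite subr_eq0 => /eqP.
Qed.

Hypothesis artR : artinian_module (R^o : lmodType R).

(** The corner ring of a primitive idempotent is local: a non-nilpotent element
    has a left multiple that is a nonzero idempotent, which must be [e]; and its
    left inverse is non-nilpotent as well. *)
Lemma primitive_local e x : primitive_idempotent e -> x = e * x * e ->
  ~ nilpotent_elt x -> exists y, [/\ y = e * y * e, y * x = e & x * y = e].
Proof.
move=> eprim; have [ee e0 _] := eprim.
have left_inv z : z = e * z * e -> ~ nilpotent_elt z ->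
    exists y, y = e * y * e /\ y * z = e.
  move=> zE zN; have [ez ze] := corner_absorb ee ee zE.
  have [f [r [ff f0 fE]]] := nonnil_idempotent artR zN.
  have fe : f * e = f by rewrite fE -mulrA ze.
  have efE : e * f = e.
    apply: primitive_corner => //.
    - by rewrite /idempotent_elt mulrA -[e * f * e]mulrA fe -mulrA ff.
    - by rewrite mulrA ee -mulrA fe.
    - by move=> ef0; apply: f0; rewrite -ff -{1}fe -mulrA ef0 mulr0.
  exists (e * r * e); split; first by rewrite !mulrA ee -[RHS]mulrA ee.
  by rewrite -mulrA ez -mulrA -fE.
move=> xE xN; have [ex xe] := corner_absorb ee ee xE.
have [y [yE yx]] := left_inv x xE xN; have [ey ye] := corner_absorb ee ee yE.
have [|z [zE zy]] := left_inv y yE.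
  move=> [n yn]; apply: e0.
  suff <- : y ^+ n * e * x ^+ n = e by rewrite yn !mul0r.
  elim: n {yn} => [|n IH]; first by rewrite mul1r mulr1.
  rewrite exprSr exprS -!mulrA [e * (x * _)]mulrA ex [y * (x * _)]mulrA yx.
  by rewrite mulrA IH.
have [ez ze] := corner_absorb ee ee zE.
have zx : z = x by rewrite -ze -yx mulrA zy ex.
by exists y; split=> //; rewrite -zx.
Qed.

(** Every [b * a] is nilpotent together with [a * (f * b * e)], which lies
    in the local ring [e R e] and is not invertible there. *)
Lemma noninvertible_jacobson e f a :
  primitive_idempotent e -> idempotent_elt f ->
  a = e * a * f -> (forall y, y = f * y * e -> a * y <> e) -> jacobson a.
Proof.
move=> eprim ff aE noinv; have [ee e0 _] := eprim.
have [ea af] := corner_absorb ee ff aE.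
apply: nil_jacobson => // b; apply: nilpotent_swap.
rewrite -ea -mulrA; apply: nilpotent_swap; apply: contrapT => abN.
have [|d [dE _ cd]] := primitive_local (x := a * b * e) eprim _ abN.
  by rewrite !mulrA ea -[RHS]mulrA ee.
have [ed de] := corner_absorb ee ee dE.
apply: (noinv (f * b * e * d)).
  by rewrite !mulrA ff -[RHS]mulrA de.
by rewrite !mulrA af.
Qed.

(** Modulo its radical, a basic artinian ring is a product of division rings,
    hence has no nilpotent elements: the Peirce components between different
    idempotents lie in the radical, and the diagonal ones are local. *)
Lemma basic_nilpotent_jacobson x : basic R -> nilpotent_elt x -> jacobson x.
Proof.
move=> [n [e [[eprim eorth esum] noniso]]] [m xm].
have ee i : idempotent_elt (e i) by case: (eprim i).
have off i j a : i != j -> a = e i * a * e j -> jacobson a.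
  move=> ij aE; apply: (noninvertible_jacobson (eprim i) (ee j) aE) => y yE ay.
  have [ea ae] := corner_absorb (ee i) (ee j) aE.
  have [ey ye] := corner_absorb (ee j) (ee i) yE.
  apply: (noniso i j ij); apply: idem_equiv_isomorphic => //.
  exists a, y; split=> //; apply: primitive_corner => //.
  - by rewrite /idempotent_elt mulrA -[y * a * y]mulrA ay ye.
  - by rewrite mulrA ey -mulrA ae.
  - move=> ya0; have [_ + _] := eprim i; apply.
    by rewrite -(ee i) -{1}ay -ay mulrA -[a * y * a]mulrA ya0 mulr0 mul0r.
have diag i : jacobson (e i * x * e i).
  set a := e i * x * e i.
  have aE : a = e i * a * e i by rewrite /a !mulrA (ee i) -[RHS]mulrA (ee i).
  have [ea ae] := corner_absorb (ee i) (ee i) aE.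
  apply: (noninvertible_jacobson (eprim i) (ee i) aE) => y yE ay.
  (* up to the radical, compression to the corner respects powers *)
  have powJ k : jacobson (a ^+ k * e i - e i * x ^+ k * e i).
    elim: k => [|k IH].
      by rewrite !mulr1 mul1r (ee i) subrr; exact: jacobson0.
    have -> : a ^+ k.+1 * e i - e i * x ^+ k.+1 * e i =
        (a ^+ k * e i - e i * x ^+ k * e i) * a
        - \sum_(j | j != i) (e i * x ^+ k * e j) * (x * e i).
      rewrite -mulr_suml -mulr_sumr.
      have -> : \sum_(j | j != i) e j = 1 - e i.
        by rewrite -esum [in RHS](bigD1 i) //= addrAC subrr add0r.
      rewrite !exprSr mulrBl -[a ^+ k * e i * a]mulrA ea -[_ * a * e i]mulrA ae.
      rewrite mulrBr mulr1 mulrBl opprB addrA.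
      have -> : e i * x ^+ k * e i * a = e i * x ^+ k * e i * (x * e i).
        by rewrite /a !mulrA -[_ * e i * e i]mulrA (ee i).
      by rewrite subrK !mulrA.
    apply: (@sub_memB _ _ (rad R)); first exact: jacobson_mulr.
    apply: (@sub_mem_sum _ _ (rad R)) => j ji; apply: jacobson_mulr => //.
    apply: (off i j); first by rewrite eq_sym.
    by rewrite !mulrA (ee i) -[RHS]mulrA (ee j).
  have ayk k : a ^+ k * e i * y ^+ k = e i.
    elim: k => [|k IH]; first by rewrite mul1r mulr1.
    rewrite exprSr exprS -[a ^+ k * a * e i]mulrA ae mulrA -[_ * a * y]mulrA ay.
    exact: IH.
  have [_ + _] := eprim i; apply; apply: jacobson_idem0 => //.
  rewrite -(ayk m); apply: jacobson_mulr => //.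
  by have := powJ m; rewrite xm mulr0 mul0r subr0.
have -> : x = \sum_i \sum_j e i * x * e j.
  under eq_bigr => i _ do rewrite -mulr_sumr esum mulr1.
  by rewrite -mulr_suml esum mul1r.
apply: (@sub_mem_sum _ _ (rad R)) => i _.
apply: (@sub_mem_sum _ _ (rad R)) => j _.
have [<-|ij] := eqVneq i j; first exact: diag.
by apply: (off i j) => //; rewrite !mulrA (ee i) -[RHS]mulrA (ee j).
Qed.

Definition orthogonal_primitives n (f : 'I_n -> R) e : Prop :=
  [/\ forall i, primitive_idempotent (f i), forall i j, i != j -> f i * f j = 0
    & \sum_i f i = e].

Lemma orthogonal_primitives_absorb n (f : 'I_n -> R) e i :
  orthogonal_primitives f e -> f i * e = f i /\ e * f i = f i.
Proof.
move=> [fprim forth <-]; have [ff _ _] := fprim i.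
rewrite mulr_sumr mulr_suml.
split; rewrite (bigD1 i) //= ff big1 ?addr0 // => j ji.
  by rewrite forth // eq_sym.
by rewrite forth.
Qed.

Lemma orthogonal_primitives_add m n (f : 'I_m -> R) (g : 'I_n -> R) e e' :
  e * e' = 0 -> e' * e = 0 -> orthogonal_primitives f e ->
  orthogonal_primitives g e' ->
  exists k (h : 'I_k -> R), orthogonal_primitives h (e + e').
Proof.
move=> ee' e'e fe ge; have [fprim forth fs] := fe; have [gprim gorth gs] := ge.
have fg i j : f i * g j = 0.
  have [<- _] := orthogonal_primitives_absorb i fe.
  have [_ <-] := orthogonal_primitives_absorb j ge.
  by rewrite mulrA -[_ * e * e']mulrA ee' mulr0 mul0r.
have gf i j : g j * f i = 0.
  have [_ <-] := orthogonal_primitives_absorb i fe.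
  have [<- _] := orthogonal_primitives_absorb j ge.
  by rewrite mulrA -[_ * e' * e]mulrA e'e mulr0 mul0r.
exists (m + n)%N, (fun k =>
  match fintype.split k with inl i => f i | inr j => g j end).
split=> [k|k l|].
- by case: (fintype.split k).
- rewrite -{1}[k]splitK -{1}[l]splitK.
  case: (fintype.split k) => i; case: (fintype.split l) => j //= kl.
    by apply: forth; apply: contra kl => /eqP ->.
  by apply: gorth; apply: contra kl => /eqP ->.
- rewrite big_split_ord -fs -gs /=; congr (_ + _); apply: eq_bigr => i _.
    case: splitP => j /=; first by move/val_inj <-.
    by move=> E; have := ltn_ord i; rewrite E ltnNge leq_addr.
  case: splitP => j /=; last by move/addnI/val_inj <-.
  by move=> E; have := ltn_ord j; rewrite -E ltnNge leq_addr.
Qed.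

(** A counterexample generating a minimal left ideal is not primitive, and
    both of its orthogonal summands generate smaller left ideals. *)
Lemma primitive_decomposition e : idempotent_elt e ->
  exists n (f : 'I_n -> R), orthogonal_primitives f e.
Proof.
move=> ee; apply: contrapT => bad.
have [|_ [f [ff fbad ->]] fmin] := artR (F := fun T => exists f,
    [/\ idempotent_elt f, ~ exists n (g : 'I_n -> R), orthogonal_primitives g f
      & T = cyclic (f : R^o)]).
  by exists (cyclic (e : R^o)), e.
have good g h : idempotent_elt g -> g * h = 0 -> f = g + h -> h * h = h ->
    h <> 0 -> exists n (p : 'I_n -> R), orthogonal_primitives p g.
  move=> gg gh fE hh h0; apply: contrapT => gbad.
  have gf : g * f = g by rewrite fE mulrDr gg gh addr0.
  have /cyclicP[a aE] : cyclic (g : R^o) f.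
    apply: (fmin (cyclic (g : R^o))); first by exists g.
      move=> _ /cyclicP[a ->]; apply/cyclicP; exists (a * g).
      by rewrite /GRing.scale /= -mulrA gf.
    by apply/cyclicP; exists 1; rewrite scale1r.
  apply: h0; have <- : f * h = h by rewrite fE mulrDl gh hh add0r.
  by rewrite aE /GRing.scale /= -mulrA gh mulr0.
apply: fbad; have [f0|f0] := pselect (f = 0).
  exists 0%N, (fun=> 0); split=> [[]//|[]//|].
  by rewrite big_ord0 f0.
apply: contrapT => fdec.
have fprim : primitive_idempotent f.
  split=> // g h gg hh gh hg fE; apply: contrapT => gh0; apply: fdec.
  have [n [p pg]] : exists n (p : 'I_n -> R), orthogonal_primitives p g.
    by apply: (good g h) => // h0; apply: gh0; right.
  have [m [q qh]] : exists n (p : 'I_n -> R), orthogonal_primitives p h.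
    apply: (good h g) => //; first by rewrite addrC.
    by move=> g0; apply: gh0; left.
  by rewrite fE; exact: orthogonal_primitives_add pg qh.
apply: fdec; exists 1%N, (fun=> f); split=> // [i j|].
  by rewrite !ord1.
by rewrite big_ord1.
Qed.

End Idempotents.

(** The comparison theorem: over a basic target the image of the radical
    consists of nilpotent elements, hence is radical, and a superfluous kernel
    contains no nonzero idempotents, hence the radical is also reflected. *)
Lemma superfluous_basic_findim (A B : pzRingType) (phi : {rmorphism A -> B}) :
  artin_algebra A -> artin_algebra B -> basic B -> finite_findim B ->
  superfluous_kernel phi -> finite_pd_morphism phi -> finite_findim A.
Proof.
move=> /artin_algebra_chain[artA noethA] /artin_algebra_chain[artB _].
move=> basicB fdB kerphi [d /pdim_leE pdB].
apply: (change_rings_findim pdB) => // x.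
  move=> /(jacobson_nilpotent artA)[n xn].
  apply: basic_nilpotent_jacobson => //; exists n.
  by rewrite -rmorphXn xn rmorph0.
move=> Jx; apply: nil_jacobson => // b; apply: contrapT => bxN.
have [f [r [ff f0 fE]]] := nonnil_idempotent artA bxN.
apply/f0/jacobson_idem0/kerphi => //; apply: jacobson_idem0 => //.
  by rewrite /idempotent_elt -rmorphM ff.
by rewrite fE mulrA rmorphM; exact: jacobson_mull.
Qed.

(** * Corner rings *)

Section CornerRing.
Variables (A : pzRingType) (e : A).
Hypothesis ee : idempotent_elt e.

(** The ring [e A e], with unit [e]; the proof of idempotency is part of the
    type because the unit law depends on it. *)
Definition corner_pred (_ : idempotent_elt e) : {pred A} :=
  fun x => e * x * e == x.

Fact corner_pred_zmod : zmod_closed (corner_pred ee).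
Proof.
split=> [|x y /eqP xE /eqP yE]; apply/eqP; first by rewrite mulr0 mul0r.
by rewrite mulrBr mulrBl xE yE.
Qed.

HB.instance Definition _ :=
  GRing.isZmodClosed.Build A (corner_pred ee) corner_pred_zmod.

Record corner := Corner { corner_val : A; _ : corner_val \in corner_pred ee }.

HB.instance Definition _ := [isSub for corner_val].
HB.instance Definition _ := [Choice of corner by <:].
HB.instance Definition _ := [SubChoice_isSubZmodule of corner by <:].

Fact compress_mem x : e * x * e \in corner_pred ee.
Proof. by apply/eqP; rewrite !mulrA ee -[LHS]mulrA ee. Qed.

Definition compress x : corner := Corner (compress_mem x).

Lemma compressE x : corner_val (compress x) = e * x * e.
Proof. by []. Qed.

Lemma corner_val_inj : injective corner_val.
Proof. exact: val_inj. Qed.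

Lemma cornerP (x : corner) :
  e * corner_val x = corner_val x /\ corner_val x * e = corner_val x.
Proof. by apply: corner_absorb => //; apply/esym/eqP; case: x. Qed.

Definition corner_mul (x y : corner) : corner :=
  compress (corner_val x * corner_val y).

Lemma corner_val_mul x y :
  corner_val (corner_mul x y) = corner_val x * corner_val y.
Proof.
have [ex _] := cornerP x; have [_ ye] := cornerP y.
by rewrite compressE mulrA ex -mulrA ye.
Qed.

Lemma corner_val_one : corner_val (compress 1) = e.
Proof. by rewrite compressE mulr1 ee. Qed.

Lemma corner_valD (x y : corner) :
  corner_val (x + y) = corner_val x + corner_val y.
Proof. by []. Qed.

Fact corner_mulA : associative corner_mul.
Proof.
by move=> x y z; apply: corner_val_inj; rewrite !corner_val_mul mulrA.
Qed.

Fact corner_mul1 : left_id (compress 1) corner_mul.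
Proof.
move=> x; apply: corner_val_inj; rewrite corner_val_mul corner_val_one.
by case: (cornerP x).
Qed.

Fact corner_1mul : right_id (compress 1) corner_mul.
Proof.
move=> x; apply: corner_val_inj; rewrite corner_val_mul corner_val_one.
by case: (cornerP x).
Qed.

Fact corner_mulDl : left_distributive corner_mul +%R.
Proof.
move=> x y z; apply: corner_val_inj.
by rewrite corner_valD !corner_val_mul corner_valD mulrDl.
Qed.

Fact corner_mulDr : right_distributive corner_mul +%R.
Proof.
move=> x y z; apply: corner_val_inj.
by rewrite corner_valD !corner_val_mul corner_valD mulrDr.
Qed.

HB.instance Definition _ := GRing.Zmodule_isPzRing.Build corner
  corner_mulA corner_mul1 corner_1mul corner_mulDl corner_mulDr.

Lemma corner_valM (x y : corner) :
  corner_val (x * y) = corner_val x * corner_val y.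
Proof. exact: corner_val_mul. Qed.

Lemma corner_val1 : corner_val 1 = e.
Proof. exact: corner_val_one. Qed.

Lemma corner_val_sum (I : Type) (r : seq I) (P : pred I) (F : I -> corner) :
  corner_val (\sum_(i <- r | P i) F i) = \sum_(i <- r | P i) corner_val (F i).
Proof. by apply: (big_morph corner_val) => [x y|]; rewrite ?corner_valD. Qed.

Section CornerModule.
Variable M : lmodType A.

(** The [e A e]-module [e M]. *)
Definition cmod_pred (_ : idempotent_elt e) : {pred M} := fun x => e *: x == x.

Fact cmod_pred_zmod : zmod_closed (cmod_pred ee).
Proof.
split=> [|x y /eqP xE /eqP yE]; apply/eqP; first by rewrite scaler0.
by rewrite scalerBr xE yE.
Qed.

HB.instance Definition _ :=
  GRing.isZmodClosed.Build M (cmod_pred ee) cmod_pred_zmod.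

Record cmod_type := Cmod { cmod_val : M; _ : cmod_val \in cmod_pred ee }.

HB.instance Definition _ := [isSub for cmod_val].
HB.instance Definition _ := [Choice of cmod_type by <:].
HB.instance Definition _ := [SubChoice_isSubZmodule of cmod_type by <:].

Fact cut_mem x : e *: x \in cmod_pred ee.
Proof. by apply/eqP; rewrite scalerA ee. Qed.

Definition cut x : cmod_type := Cmod (cut_mem x).

Lemma cutE x : cmod_val (cut x) = e *: x.
Proof. by []. Qed.

Lemma cmod_val_inj : injective cmod_val.
Proof. exact: val_inj. Qed.

Lemma cmodP (x : cmod_type) : e *: cmod_val x = cmod_val x.
Proof. by apply/eqP; case: x. Qed.

Lemma cmod_valD (x y : cmod_type) : cmod_val (x + y) = cmod_val x + cmod_val y.
Proof. by []. Qed.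

Definition cmod_scale (c : corner) (x : cmod_type) : cmod_type :=
  cut (corner_val c *: cmod_val x).

Lemma cmod_val_scale c x :
  cmod_val (cmod_scale c x) = corner_val c *: cmod_val x.
Proof. by rewrite cutE scalerA; have [-> _] := cornerP c. Qed.

Fact cmod_scaleA a b x : cmod_scale a (cmod_scale b x) = cmod_scale (a * b) x.
Proof.
by apply: cmod_val_inj; rewrite !cmod_val_scale corner_valM scalerA.
Qed.

Fact cmod_scale1 : left_id 1 cmod_scale.
Proof.
by move=> x; apply: cmod_val_inj; rewrite cmod_val_scale corner_val1 cmodP.
Qed.

Fact cmod_scaleDr : right_distributive cmod_scale +%R.
Proof.
move=> a x y; apply: cmod_val_inj.
by rewrite cmod_valD !cmod_val_scale cmod_valD scalerDr.
Qed.

Fact cmod_scaleDl x : {morph cmod_scale^~ x : a b / a + b}.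
Proof.
move=> a b; apply: cmod_val_inj.
by rewrite cmod_valD !cmod_val_scale corner_valD scalerDl.
Qed.

HB.instance Definition _ := GRing.Zmodule_isLmodule.Build corner cmod_type
  cmod_scaleA cmod_scale1 cmod_scaleDr cmod_scaleDl.

Definition cmod : lmodType corner := cmod_type.

Lemma cmod_valZ (c : corner) (x : cmod) :
  cmod_val (c *: x) = corner_val c *: cmod_val x.
Proof. exact: cmod_val_scale. Qed.

Lemma cmod_val0 : cmod_val (0 : cmod) = 0.
Proof. by []. Qed.

Lemma cmod_val_sum (I : Type) (r : seq I) (P : pred I) (F : I -> cmod) :
  cmod_val (\sum_(i <- r | P i) F i) = \sum_(i <- r | P i) cmod_val (F i).
Proof. by apply: (big_morph cmod_val) => [x y|]; rewrite ?cmod_valD. Qed.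

Lemma cutD x y : cut (x + y) = cut x + cut y :> cmod.
Proof. by apply: cmod_val_inj; rewrite cmod_valD !cutE scalerDr. Qed.

End CornerModule.

Lemma cmap_mem (M N : lmodType A) (f : {linear M -> N}) (x : cmod M) :
  e *: f (cmod_val x) = f (cmod_val x).
Proof. by rewrite -linearZ cmodP. Qed.

Fact cmap_linear (M N : lmodType A) (f : {linear M -> N}) :
  linear (fun x : cmod M => cut (f (cmod_val x)) : cmod N).
Proof.
move=> a x y; apply: cmod_val_inj.
rewrite [RHS]cmod_valD cmod_valZ !cutE !(cmap_mem f) cmod_valD cmod_valZ.
exact: linearP.
Qed.

Definition cmap (M N : lmodType A) (f : {linear M -> N}) :
  {linear cmod M -> cmod N} :=
  mkLinear (cmap_linear f).

Lemma cmapE (M N : lmodType A) (f : {linear M -> N}) (x : cmod M) :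
  cmod_val (cmap f x) = f (cmod_val x).
Proof. exact: cmap_mem. Qed.

Lemma cmap_surj (M N : lmodType A) (f : {linear M -> N}) :
  surjective_map f -> surjective_map (cmap f).
Proof.
move=> fs y; have [x xE] := fs (cmod_val y); exists (cut x).
by apply: cmod_val_inj; rewrite cmapE cutE linearZ /= xE cmodP.
Qed.

Lemma cmap_ses (K P M : lmodType A)
    (i : {linear K -> P}) (p : {linear P -> M}) :
  ses i p -> ses (cmap i) (cmap p).
Proof.
move=> [iI ps ex]; split=> [x y /(congr1 (@cmod_val _))||x].
- by rewrite !cmapE => /iI /cmod_val_inj.
- exact: cmap_surj.
split=> [/(congr1 (@cmod_val _))|[y <-]].
  rewrite cmapE => /ex[y yE]; exists (cut y).
  by apply: cmod_val_inj; rewrite cmapE cutE linearZ /= yE cmodP.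
apply: cmod_val_inj; rewrite !cmapE cmod_val0; apply/ex.
by exists (cmod_val y).
Qed.

(** * Morita equivalence for a full idempotent *)

Variables (r : nat) (a b : 'I_r -> A).
Hypothesis full : \sum_j a j * e * b j = 1.

Lemma full_scale (M : lmodType A) (x : M) : \sum_j a j *: (e *: (b j *: x)) = x.
Proof.
rewrite -[RHS]scale1r -full scaler_suml; apply: eq_bigr => j _.
by rewrite !scalerA.
Qed.

(** Inserting [1 = \sum_j a j * e * b j] moves coefficients into the corner;
    this turns generators, and also dual bases, of [M] into those of [e M]. *)
Lemma cmod_expand (M : lmodType A) n (c : 'I_n -> A) (g : 'I_n -> M)
    (x : cmod M) :
  cmod_val x = \sum_i c i *: g i ->
  x = \sum_(t : 'I_n * 'I_r)
        compress (c t.1 * a t.2) *: cut (b t.2 *: g t.1) :> cmod M.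
Proof.
move=> xE; apply: cmod_val_inj; rewrite cmod_val_sum.
transitivity (\sum_(t : 'I_n * 'I_r)
    (e * (c t.1 * a t.2) * e) *: (b t.2 *: g t.1)).
  rewrite -(pair_bigA _ (fun i j => (e * (c i * a j) * e) *: (b j *: g i))) /=.
  rewrite -cmodP xE scaler_sumr; apply: eq_bigr => i _.
  rewrite -[g i in LHS]full_scale !scaler_sumr; apply: eq_bigr => j _.
  by rewrite !scalerA !mulrA.
apply: eq_bigr => t _.
by rewrite cmod_valZ cutE compressE !scalerA -!mulrA [e * (e * _)]mulrA ee.
Qed.

Lemma cmod_fg (M : lmodType A) :
  finitely_generated M -> finitely_generated (cmod M).
Proof.
move=> [n [g gP]]; pose y (t : 'I_n * 'I_r) : cmod M := cut (b t.2 *: g t.1).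
exists #|{: 'I_n * 'I_r}|, (fun k => y (enum_val k)) => x.
have [c cE] := gP (cmod_val x).
pose d (t : 'I_n * 'I_r) := compress (c t.1 * a t.2).
exists (fun k => d (enum_val k)); rewrite {1}(cmod_expand cE).
rewrite (reindex (@enum_val _ {: 'I_n * 'I_r})) //=.
exact/onW_bij/enum_val_bij.
Qed.

Lemma fg_projective_dual_basis (M : lmodType A) : finitely_generated M ->
  projective M -> exists n (phi : 'I_n -> {linear M -> A^o}) (g : 'I_n -> M),
    forall x, x = \sum_i (phi i x : A) *: g i.
Proof.
move=> /fg_cover[n [p ps]] projM; have [s sP] := projective_split projM ps.
exists n, (fun i => coord A i \o s), (fun i => p 'e_i) => x.
rewrite -{1}[x]sP [s x in LHS]row_sum_delta linear_sum.
by apply: eq_bigr => i _; rewrite linearZ.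
Qed.

Lemma cmod_projective (M : lmodType A) : finitely_generated M -> projective M ->
  projective (cmod M).
Proof.
move=> fgM /(fg_projective_dual_basis fgM)[n [phi [g gP]]].
have psiL (t : 'I_n * 'I_r) :
    linear (fun x : cmod M =>
      compress ((phi t.1 (cmod_val x) : A) * a t.2) : corner^o).
  move=> c x y; apply: corner_val_inj.
  have -> : c *: (compress ((phi t.1 (cmod_val x) : A) * a t.2) : corner^o) =
    c * compress ((phi t.1 (cmod_val x) : A) * a t.2) by [].
  rewrite corner_valD corner_valM !compressE cmod_valD cmod_valZ linearP.
  rewrite mulrDl mulrDr mulrDl; congr (_ + _); have [ec ce] := cornerP c.
  by rewrite /GRing.scale /= !mulrA ec ce.
apply: (@dual_basis_projective _ _ _ (fun t => mkLinear (psiL t))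
  (fun t => cut (b t.2 *: g t.1))) => x.
exact: cmod_expand (gP (cmod_val x)).
Qed.

(** A lift [h] on [e M] extends to [M] by [x |-> \sum_j a j * h (e * b j *
    x)], which is linear because the [a j] and [b j] resolve the identity. *)
Lemma cmod_projective_reflect (M : lmodType A) :
  projective (cmod M) -> projective M.
Proof.
move=> projM U V u f us.
have [h hP] := projM _ _ (cmap u) (cmap f) (cmap_surj us).
have hcut c x : h (cut (c *: x)) =
    \sum_j compress (c * a j) *: h (cut (b j *: x)).
  rewrite (_ : cut (c *: x) =
    \sum_j compress (c * a j) *: cut (b j *: x) :> cmod M).
    by rewrite linear_sum; apply: eq_bigr => j _; rewrite linearZ.
  apply: cmod_val_inj; rewrite cmod_val_sum cutE -{1}[x]full_scale !scaler_sumr.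
  apply: eq_bigr => j _.
  by rewrite cmod_valZ cutE compressE !scalerA -!mulrA [e * (e * _)]mulrA ee.
have kL : linear (fun x => \sum_j a j *: cmod_val (h (cut (b j *: x)))).
  move=> c x y.
  under eq_bigr => j _ do rewrite scalerDr cutD linearD cmod_valD scalerDr.
  rewrite big_split /=; congr (_ + _).
  under eq_bigr => j _ do rewrite scalerA hcut cmod_val_sum scaler_sumr.
  rewrite exchange_big scaler_sumr; apply: eq_bigr => k _.
  under eq_bigr => j _ do rewrite cmod_valZ compressE scalerA.
  rewrite -scaler_suml.
  have -> : \sum_j a j * (e * (b j * c * a k) * e) = c * a k * e.
    rewrite -[RHS]mul1r -full mulr_suml; apply: eq_bigr => j _.
    by rewrite !mulrA.
  by rewrite -!scalerA cmodP.
exists (mkLinear kL) => x.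
rewrite mkLinearE -[in RHS](full_scale x) !linear_sum.
apply: eq_bigr => j _.
have uhE : u (cmod_val (h (cut (b j *: x)))) = f (e *: (b j *: x)).
  by rewrite -cmapE hP cmapE cutE.
by rewrite [LHS]linearZ uhE [RHS]linearZ.
Qed.

Hypothesis noethA : noetherian_module (A^o : lmodType A).

Lemma fg_syzygy (M : lmodType A) : finitely_generated M ->
  exists n (K : lmodType A) (i : {linear K -> 'rV[A]_n})
    (p : {linear 'rV[A]_n -> M}),
    finitely_generated K /\ ses i p.
Proof.
move=> /fg_cover[n [p ps]].
exists n, (carrier (sub_ker p)), (incl (sub_ker p)), p.
by split; [exact/fg_sub_carrier/noetherian_row|exact: ses_ker].
Qed.

Lemma cmod_row_projective n : projective (cmod 'rV[A]_n).
Proof.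
apply: cmod_projective; last exact: row_projective.
by apply: (cover_fg (p := idfun)) => x; exists x.
Qed.

Lemma cmod_pdim m (M : lmodType A) : finitely_generated M ->
  pdim_le m M -> pdim_le m (cmod M).
Proof.
elim: m M => [|m IH] M fgM; first exact: cmod_projective.
have [n [K [i [p [fgK ip]]]]] := fg_syzygy fgM.
move=> /(pdim_le_syzygy ip (@row_projective A n)) pdK.
exists (cmod 'rV[A]_n), (cmod K), (cmap i), (cmap p).
by split; [exact: cmod_row_projective|exact: cmap_ses|exact: IH].
Qed.

Lemma cmod_pdim_reflect m (M : lmodType A) : finitely_generated M ->
  pdim_le m (cmod M) -> pdim_le m M.
Proof.
elim: m M => [|m IH] M fgM; first exact: cmod_projective_reflect.
have [n [K [i [p [fgK ip]]]]] := fg_syzygy fgM.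
move=> /(pdim_le_syzygy (cmap_ses ip) (@cmod_row_projective n)) pdK.
exists 'rV[A]_n, K, i, p.
by split; [exact: row_projective| |exact: IH].
Qed.

(** Passing to [e M] is exact, and it preserves and reflects projectivity,
    so it preserves projective dimension. *)
Theorem corner_findim : finite_findim corner -> finite_findim A.
Proof.
move=> [n fdS]; exists n => M fgM [m /pdim_leE pdM].
apply/pdim_leE/cmod_pdim_reflect => //.
apply/pdim_leE/fdS; first exact: cmod_fg.
by exists m; apply/pdim_leE/cmod_pdim.
Qed.

End CornerRing.

Section CornerAlgebra.
Variables (A : pzRingType) (e : A) (ee : idempotent_elt e).
Variables (k : comPzRingType) (s : {rmorphism k -> A}).
Hypothesis sC : forall c x, s c * x = x * s c.

Definition corner_scalar (_ : forall c x, s c * x = x * s c) (c : k) :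
  corner ee :=
  compress ee (s c).

Lemma corner_scalarE c : corner_val (corner_scalar sC c) = s c * e.
Proof. by rewrite compressE -sC -mulrA ee. Qed.

Fact corner_scalar_zmod : zmod_morphism (corner_scalar sC).
Proof.
move=> x y; apply: corner_val_inj.
rewrite corner_scalarE rmorphB mulrBl -!corner_scalarE.
by [].
Qed.

Fact corner_scalar_monoid : monoid_morphism (corner_scalar sC).
Proof.
split=> [|x y]; apply: corner_val_inj.
  by rewrite corner_scalarE rmorph1 mul1r corner_val1.
rewrite corner_valM !corner_scalarE rmorphM [RHS]mulrA -[s x * e * s y]mulrA.
by rewrite -(sC y e) !mulrA -[RHS]mulrA ee.
Qed.

HB.instance Definition _ := GRing.isZmodMorphism.Build k (corner ee)
  (corner_scalar sC) corner_scalar_zmod.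
HB.instance Definition _ := GRing.isMonoidMorphism.Build k (corner ee)
  (corner_scalar sC) corner_scalar_monoid.

Lemma corner_artin_algebra : left_artinian k ->
  finitely_generated (right_restriction s) -> artin_algebra (corner ee).
Proof.
move=> art [n [g gP]]; exists k, (corner_scalar sC); split=> //.
  move=> c x; apply: corner_val_inj; rewrite !corner_valM corner_scalarE.
  have [ex xe] := cornerP x.
  by rewrite -mulrA ex (sC c (corner_val x)) (sC c e) mulrA xe.
exists n, (fun i => compress ee (g i)) => x.
have [c cE] := gP (corner_val x); exists c; apply: corner_val_inj.
have [ex xe] := cornerP x.
rewrite corner_val_sum -{1}ex -{1}xe {1}cE mulr_suml mulr_sumr.
apply: eq_bigr => i _.
rewrite [RHS]corner_valM corner_scalarE compressE [c i *: g i]/(g i * s (c i)).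
by rewrite -!mulrA [e * (s _ * e)]mulrA -(sC (c i) e) -[_ * e * e]mulrA ee.
Qed.

End CornerAlgebra.

(** * The basic algebra of an Artin algebra *)

Section BasicCorner.
Variables (A : pzRingType) (n : nat) (f : 'I_n -> A).
Hypothesis fprim : orthogonal_primitives f 1.

Let ff i : idempotent_elt (f i).
Proof. by have [/(_ i)[]] := fprim. Qed.

(** One index for each isomorphism class of the modules [A (f i)]. *)
Definition reps : {set 'I_n} :=
  [set i : 'I_n |
    [forall j : 'I_n, (j < i)%N ==> ~~ `[< idem_equiv (f j) (f i) >]]].

Definition basic_idem : A := \sum_(i in reps) f i.

(** The least index of an equivalence class is in [reps]. *)
Lemma reps_equiv i : exists2 j, j \in reps & idem_equiv (f j) (f i).
Proof.
have [|j /asboolP ji jmin] :=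
    @arg_minnP 'I_n i (fun j => `[< idem_equiv (f j) (f i) >]) (@nat_of_ord n).
  by apply/asboolP/idem_equiv_refl.
exists j => //; rewrite inE; apply/forallP => l; apply/implyP => lj.
apply/negP => /asboolP elj; move: lj; rewrite ltnNge jmin //.
by apply/asboolP; exact: idem_equiv_trans elj ji.
Qed.

Lemma reps_inj i j :
  i \in reps -> j \in reps -> idem_equiv (f i) (f j) -> i = j.
Proof.
rewrite !inE => /forallP iR /forallP jR eij; apply: val_inj => /=.
have eji := idem_equiv_sym eij.
case: (ltngtP i j) => // lt.
  by have /implyP/(_ lt)/negP[] := jR i; apply/asboolP.
by have /implyP/(_ lt)/negP[] := iR j; apply/asboolP.
Qed.

Lemma basic_idem_absorb i : i \in reps ->
  f i * basic_idem = f i /\ basic_idem * f i = f i.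
Proof.
have [_ forth _] := fprim; move=> iR.
rewrite /basic_idem mulr_sumr mulr_suml.
split; rewrite (bigD1 i) //= ff big1 ?addr0 // => j /andP[_ ji].
  by rewrite forth // eq_sym.
by rewrite forth.
Qed.

Lemma basic_idem_idem : idempotent_elt basic_idem.
Proof.
rewrite /idempotent_elt {1}/basic_idem mulr_suml; apply: eq_bigr => i iR.
by have [] := basic_idem_absorb iR.
Qed.

Lemma basic_idem_full :
  exists a b : 'I_n -> A, \sum_i a i * basic_idem * b i = 1.
Proof.
have /choice[u uP] : forall i,
    exists xy : A * A, xy.1 * basic_idem * xy.2 = f i.
  move=> i; have [j jR eji] := reps_equiv i.
  have [x [y [xE yE xy yx]]] := idem_equiv_sym eji.
  exists (x, y) => /=; rewrite xE -[_ * f j * _]mulrA.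
  by have [-> _] := basic_idem_absorb jR; rewrite -xE.
exists (fun i => (u i).1), (fun i => (u i).2).
have [_ _ <-] := fprim; apply: eq_bigr => i _; exact: uP.
Qed.

Lemma basic_corner : basic (corner basic_idem_idem).
Proof.
have [prim orth sum1] := fprim.
pose g i : corner basic_idem_idem := compress basic_idem_idem (f i).
have gE i : i \in reps -> corner_val (g i) = f i.
  by move=> iR; have [fe ef] := basic_idem_absorb iR; rewrite compressE ef fe.
have gg i : i \in reps -> idempotent_elt (g i).
  by move=> iR; apply: corner_val_inj; rewrite corner_valM gE // ff.
have evR (i : 'I_#|reps|) : enum_val i \in reps by exact: enum_valP.
exists #|reps|, (fun i => g (enum_val i)); split; first split.
- move=> i; split=> [|g0|x y xx yy xy yx gxy]; first exact: gg.
    have [_ + _] := prim (enum_val i); apply.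
    by rewrite -gE // g0.
  have [_ _ iprim] := prim (enum_val i).
  have [|||||x0|y0] := iprim (corner_val x) (corner_val y).
  + by rewrite /idempotent_elt -corner_valM xx.
  + by rewrite /idempotent_elt -corner_valM yy.
  + by rewrite -corner_valM xy.
  + by rewrite -corner_valM yx.
  + by rewrite -gE // gxy.
  + by left; apply: corner_val_inj.
  + by right; apply: corner_val_inj.
- move=> i j ij; apply: corner_val_inj; rewrite corner_valM !gE // orth //.
  by apply: contra ij => /eqP/enum_val_inj ->.
- apply: corner_val_inj; rewrite corner_val1 corner_val_sum /basic_idem.
  rewrite [RHS]big_enum_val; apply: eq_bigr => i _; exact: gE.
move=> i j ij iso; move/negP: ij; apply; apply/eqP/enum_val_inj/reps_inj => //.
have [x [y [xE yE xy yx]]] :=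
  isomorphic_idem_equiv (gg _ (evR i)) (gg _ (evR j)) iso.
exists (corner_val x), (corner_val y).
by rewrite -(gE _ (evR i)) -(gE _ (evR j)) -!corner_valM -xE -yE xy yx.
Qed.

End BasicCorner.

(** The sum of one primitive idempotent from each isomorphism class is full,
    because every other primitive idempotent factors through an equivalent
    one; its corner is basic. *)
Lemma basic_reduction (A : pzRingType) : artin_algebra A ->
  exists S : pzRingType, [/\ artin_algebra S, basic S
    & finite_findim S -> finite_findim A].
Proof.
move=> artA; have [artinA noethA] := artin_algebra_chain artA.
have [n [f fprim]] := primitive_decomposition artinA (mul1r 1).
have ee := basic_idem_idem fprim.
exists (corner (basic_idem_idem fprim)); split.
- have [k [s [art sC fgA]]] := artA; exact: corner_artin_algebra sC art fgA.
- exact: basic_corner.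
- have [a [b ab]] := basic_idem_full fprim; exact: corner_findim ab noethA.
Qed.

(** The restriction of [A] along the identity is free on 1. *)
Lemma identity_finite_pd (A : pzRingType) :
  finite_pd_morphism (idfun : {rmorphism A -> A}).
Proof.
exists 0%N; apply/pdim_leE.
have phiL : linear
    (fun x : right_restriction (idfun : {rmorphism A -> A}) => x : A^c^o).
  by [].
apply: (@dual_basis_projective _ _ 'I_1 (fun=> mkLinear phiL)
  (fun=> (1 : A) : right_restriction idfun)) => x.
by rewrite big_ord1; exact/esym/mul1r.
Qed.

Theorem corollary3p15 :
  (forall A : pzRingType, artin_algebra A -> finite_findim A)
  <->
  (forall A : pzRingType, artin_algebra A -> basic A ->
     exists B : pzRingType,
       [/\ artin_algebra B, basic B, finite_findim B
         & exists phi : {rmorphism A -> B},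
             superfluous_kernel phi /\ finite_pd_morphism phi]).
Proof.
split=> [fdc A artA basicA|cond A artA].
  exists A; split=> //; first exact: fdc.
  exists idfun; split; last exact: identity_finite_pd.
  by move=> a a0; rewrite (_ : a = 0) //; exact: jacobson0.
have [S [artS basicS]] := basic_reduction artA; apply.
have [B [artB basicB fdB [phi [kerphi pdphi]]]] := cond S artS basicS.
exact: superfluous_basic_findim kerphi pdphi.
Qed.
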